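(* Work in 3-dimensional Euclidean space $\mathbb{R}^3$, hyperbolic space $H^3$, or elliptic space $\mathbb{RP}^3$. Let $L$ and $M$ be a pair of skew (i.e. non-coplanar) lines. Choose a triple of points $A_1,A_2,A_3$ on $L$ and a triple of points $B_1,B_2,B_3$ on $M$, in general position. Write $(A_iB_j)$ for the line through $A_i$ and $B_j$. Then the three lines $$S((A_1 B_2),(A_2 B_1)),\quad S((A_2 B_3),(A_3 B_2)),\quad S((A_3 B_1),(A_1 B_3))$$ share a skewer, i.e. there is a line that intersects all three of them at right angle.
   Context: A skewer of two lines is a line that intersects both of them at right angle; $S(a,b)$ denotes the skewer of $a$ and $b$. Several lines share a skewer if some line intersects each of them at right angle. Elliptic space $\mathbb{RP}^3$ is the quotient of the unit sphere $S^3\subset\mathbb{R}^4$ by the antipodal map; a line $\ell$ is the projectivization of a 2-plane in $\mathbb{R}^4$ and its dual line $\ell^*$ is the projectivization of the orthogonal complement of that plane. In $\mathbb{RP}^3$ a generic pair of lines has exactly two skewers, dual to each other. There ''unique'' means unique up to replacing the skewer by its dual, $S(a,b)$ is either of the two, and the statement is asserted for any choice. General position: each time one needs to draw a skewer of two lines, this operation is well defined and unique (in elliptic space, up to duality). This is required for every expression $S(\cdot,\cdot)$ in the statement and for the common skewer in the conclusion, i.e. some two of the three concluding lines have a unique skewer. It holds on a Zariski open subset of the set of initial data. *)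

(* Defs.v *)
From mathcomp Require Import all_boot all_order all_algebra.
From mathcomp Require Import boolp classical_sets reals.

Set Implicit Arguments.
Unset Strict Implicit.
Unset Printing Implicit Defensive.

Import Order.TTheory GRing.Theory Num.Theory.
Local Open Scope classical_set_scope.
Local Open Scope ring_scope.

(* Lines and planes are sets of points, so that equality of lines is =.
   - [line_through A B] is the line through A and B; it is meaningful only when
     A and B are distinct.
   - [direction l p u]: the line l passes through p and has the nonzero tangent
     vector u at p.
   - [inner] is the inner product of tangent vectors at a common point.
   - [dual_line l m]: m is the dual line of l (only elliptic lines have one). *)
Record geometry (R : realType) : Type := Geometry {
  pt : Type;
  vect : Type;
  is_line : set pt -> Prop;
  is_plane : set pt -> Prop;
  line_through : pt -> pt -> set pt;
  direction : set pt -> pt -> vect -> Prop;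
  inner : vect -> vect -> R;
  dual_line : set pt -> set pt -> Prop
}.

Section Skewers.
Variables (R : realType) (G : geometry R).
Implicit Types a b l m s t : set (pt G).

Definition coplanar l m : Prop :=
  exists P : set (pt G), [/\ is_plane P, l `<=` P & m `<=` P].

Definition meet_at_right_angle l m : Prop :=
  exists (p : pt G) (u v : vect G),
    [/\ direction l p u, direction m p v & inner u v = 0].

Definition skewer s a b : Prop :=
  [/\ is_line s, meet_at_right_angle s a & meet_at_right_angle s b].

(* S(a, b) is well defined and unique up to duality, and s is a choice of it. *)
Definition is_the_skewer s a b : Prop :=
  skewer s a b /\ forall t, skewer t a b -> t = s \/ dual_line s t.

Definition has_unique_skewer a b : Prop := exists s, is_the_skewer s a b.

End Skewers.

Definition dot (R : realType) (n : nat) (x y : 'rV[R]_n) : R :=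
  \sum_(i < n) x 0 i * y 0 i.

Section Euclidean.
Variable R : realType.
Local Notation V := 'rV[R]_3.

Definition flat (p : V) (U : {vspace V}) : set V := [set x | x - p \in U].

Definition euclidean : geometry R := {|
  pt := V;
  vect := V;
  is_line := fun l =>
    exists (p : V) (U : {vspace V}), \dim U = 1%N /\ l = flat p U;
  is_plane := fun P =>
    exists (p : V) (U : {vspace V}), \dim U = 2%N /\ P = flat p U;
  line_through := fun A B => flat A <[B - A]>%VS;
  direction := fun l p u => u != 0 /\ l = flat p <[u]>%VS;
  inner := @dot R 3;
  dual_line := fun _ _ => False
|}.

End Euclidean.

Section Hyperbolic.
Variable R : realType.
Local Notation V := 'rV[R]_4.

Definition lorentz (x y : V) : R :=
  - (x 0 ord0 * y 0 ord0) + \sum_(i < 3) x 0 (lift ord0 i) * y 0 (lift ord0 i).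

(* The hyperboloid model of H^3. *)
Definition hpoint : Type :=
  {x : V | (lorentz x x == -1) && (0 < x 0 ord0)}.

Definition htrace (U : {vspace V}) : set hpoint := [set x | val x \in U].

(* The tangent space of the hyperboloid at p is the Lorentz-orthogonal
   complement of p, on which the Lorentz form is positive definite. *)
Definition hyperbolic : geometry R := {|
  pt := hpoint;
  vect := V;
  is_line := fun l =>
    exists U : {vspace V}, [/\ \dim U = 2%N, l = htrace U & l !=set0];
  is_plane := fun P =>
    exists U : {vspace V}, [/\ \dim U = 3%N, P = htrace U & P !=set0];
  line_through := fun A B => htrace (<[val A]> + <[val B]>)%VS;
  direction := fun l p u =>
    [/\ u != 0, lorentz (val p) u = 0 & l = htrace (<[val p]> + <[u]>)%VS];
  inner := lorentz;
  dual_line := fun _ _ => False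
|}.

End Hyperbolic.

Section Elliptic.
Variable R : realType.
Local Notation V := 'rV[R]_4.

(* An antipodal pair of unit vectors is identified with the vector line that
   it spans. *)
Definition epoint : Type := {p : {vspace V} | \dim p == 1%N}.

Definition proj (U : {vspace V}) : set epoint := [set p | (val p <= U)%VS].

Definition orthocomplement (U W : {vspace V}) : Prop :=
  forall w : V, w \in W <-> (forall u : V, u \in U -> dot u w = 0).

(* A tangent vector at p is lifted to S^3, hence given, up to sign, by a vector
   orthogonal to p; the line and the right angles that it determines do not
   depend on the sign. *)
Definition elliptic : geometry R := {|
  pt := epoint;
  vect := V;
  is_line := fun l => exists U : {vspace V}, \dim U = 2%N /\ l = proj U;
  is_plane := fun P => exists U : {vspace V}, \dim U = 3%N /\ P = proj U;
  line_through := fun A B => proj (val A + val B)%VS;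
  direction := fun l p u =>
    [/\ u != 0, (forall x : V, x \in val p -> dot x u = 0)
      & l = proj (val p + <[u]>)%VS];
  inner := @dot R 4;
  dual_line := fun l m => exists U W : {vspace V},
    [/\ \dim U = 2%N, orthocomplement U W, l = proj U & m = proj W]
|}.

End Elliptic.

Inductive space_kind : Type := Euclidean3 | Hyperbolic3 | Elliptic3.

Definition geometry_of (R : realType) (X : space_kind) : geometry R :=
  match X with
  | Euclidean3 => euclidean R
  | Hyperbolic3 => hyperbolic R
  | Elliptic3 => elliptic R
  end.

(* Main.v *)
Require Import Defs.
From HB Require Import structures.
From mathcomp Require Import all_boot all_order all_algebra.
From mathcomp Require Import boolp classical_sets reals.
From mathcomp Require Import ring lra.

(** Let K be the ring R[e] with e^2 = k, where k is 1 for elliptic, 0 for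
    Euclidean and -1 for hyperbolic space.  A line has Pluecker coordinates
    (u, m), direction and moment, which form one vector q = u + e m of K^3.
    For two lines

      q.q' = (u.u' + k m.m') + e (u.m' + m.u'),

    whose e-part vanishes when the lines are coplanar and whose real part then
    measures their angle: the lines meet at right angle exactly when
    q.q' = 0 ([meet_at_right_angleP]).  Thus over K the geometry of lines is
    that of vectors of K^3: the skewer of a and b is a multiple of the
    cross product of qa and qb, and three lines with linearly dependent vectors
    should share a skewer.

    The coordinates of the line through A and B are bilinear in the homogeneous
    coordinates of A and B.  Those of the A_i stay in one plane of R^4, those
    of the B_j in another, so the three cross products come from a bilinear map
    f on pairs of 2-dimensional vectors.  That they are dependent is the
    identity [pappus_identity], valid over every commutative ring: for generic
    a_i and b_j one may rescale so that a_1 + a_2 + a_3 = b_1 + b_2 + b_3 = 0;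
    then, with q_ij = f(a_i, b_j), the vectors q_12 - q_21, q_23 - q_32 and
    q_31 - q_13 coincide, and their common value is orthogonal to the cross
    products of q_12 and q_21, of q_23 and q_32, of q_31 and q_13.

    Not every vector of K^3 comes from a line, and K is not a field when k is
    1 or 0, so a cross product must still be compared with the skewer that it
    stands for.  If qa x qb = d qs with d not invertible, then some z <> 0 kills
    d, and a screw motion about a with a multiple of z as parameter moves the
    skewer s to another skewer ([second_perpendicular]), which is neither s nor
    its dual.  Uniqueness therefore makes d invertible
    ([unique_skewer_cross]).  So the determinant of the vectors of
    the three lines vanishes, and the unique skewer of two of them, being an
    invertible multiple of their cross product, meets the third at right angle.

    [klein_model] collects what this argument uses of a geometry, and the three
    spaces are shown to be models of it. *)

Set Implicit Arguments.
Unset Strict Implicit.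
Unset Printing Implicit Defensive.
Import Order.TTheory GRing.Theory Num.Theory.
Local Open Scope classical_set_scope.
Local Open Scope ring_scope.

(** * Vectors over a commutative ring *)

Section Vec.
Variable A : comNzRingType.
Definition vec3 : Type := (A * A * A)%type.
Implicit Types (x y z : vec3) (c : A).
Definition vdot x y : A := x.1.1 * y.1.1 + x.1.2 * y.1.2 + x.2 * y.2.
Definition vcross x y : vec3 :=
  (x.1.2 * y.2 - x.2 * y.1.2, x.2 * y.1.1 - x.1.1 * y.2,
   x.1.1 * y.1.2 - x.1.2 * y.1.1).
Definition vadd x y : vec3 := (x.1.1 + y.1.1, x.1.2 + y.1.2, x.2 + y.2).
Definition vscale c x : vec3 := (c * x.1.1, c * x.1.2, c * x.2).

(** q is an arbitrary bilinear map on pairs of vectors (a, a') and (b, b'),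
    given by its four values on basis vectors. *)
Lemma pappus_identity (f11 f12 f21 f22 : vec3)
    (a1 a1' a2 a2' a3 a3' b1 b1' b2 b2' b3 b3' : A) :
  let q a a' b b' := vadd (vadd (vscale (a * b) f11) (vscale (a * b') f12))
                          (vadd (vscale (a' * b) f21) (vscale (a' * b') f22)) in
  vdot (vcross (q a1 a1' b2 b2') (q a2 a2' b1 b1'))
   (vcross (vcross (q a2 a2' b3 b3') (q a3 a3' b2 b2'))
           (vcross (q a3 a3' b1 b1') (q a1 a1' b3 b3'))) = 0.
Proof.
case: f11 => [[f g] h]; case: f12 => [[f' g'] h'].
case: f21 => [[i j] k]; case: f22 => [[i' j'] k'] /=.
rewrite /vdot /vcross /vadd /vscale /=.
ring.
Qed.
End Vec.

Section VecTheory.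
Variable A : comNzRingType.
Implicit Types (x y z : vec3 A) (c : A).

Lemma vdotC x y : vdot x y = vdot y x.
Proof. by rewrite /vdot; ring. Qed.

Lemma vdotZl c x y : vdot (vscale c x) y = c * vdot x y.
Proof. by rewrite /vdot /=; ring. Qed.

Lemma vdotZr c x y : vdot x (vscale c y) = c * vdot x y.
Proof. by rewrite /vdot /=; ring. Qed.

Lemma vscaleA c d x : vscale c (vscale d x) = vscale (c * d) x.
Proof. by rewrite /vscale /=; congr (_, _, _); ring. Qed.

Lemma vscale1 x : vscale 1 x = x.
Proof. by case: x => [[? ?] ?]; rewrite /vscale /= !mul1r. Qed.

Lemma vcrossZ c d x y :
  vcross (vscale c x) (vscale d y) = vscale (c * d) (vcross x y).
Proof. by rewrite /vcross /vscale /=; congr (_, _, _); ring. Qed.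

Lemma vdot_cross_rot x y z : vdot x (vcross y z) = vdot y (vcross z x).
Proof. by rewrite /vdot /=; ring. Qed.

Lemma vscale0 x : vscale 0 x = (0, 0, 0).
Proof. by rewrite /vscale !mul0r. Qed.

Lemma vaddv0 x : vadd x (0, 0, 0) = x.
Proof. by case: x => [[? ?] ?]; rewrite /vadd /= !addr0. Qed.

(** Let n be the cross product of x and y.  That of s and n is
    (s.y) x - (s.x) y = 0, and taking the cross product with s once more gives
    (s.n) s - (s.s) n = 0. *)
Lemma cross_perp_collinear s x y i :
  vdot s x = 0 -> vdot s y = 0 -> vdot s s * i = 1 ->
  vcross x y = vscale (i * vdot s (vcross x y)) s.
Proof.
move=> sx sy si.
have e : vscale (vdot s s) (vcross x y) =
    vadd (vscale (vdot s (vcross x y)) s)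
         (vadd (vscale (vdot s x) (vcross s y))
               (vscale (- vdot s y) (vcross s x))).
  by rewrite /vcross /vadd /vscale /vdot /=; congr (_, _, _); ring.
move: e; rewrite sx sy oppr0 !vscale0 !vaddv0 => e.
by rewrite -vscaleA -e vscaleA mulrC si vscale1.
Qed.

(** Up to scale, t is s rotated about the axis x; with coefficients in R[e]
    such rotations are the screw motions. *)
Section Rotate.
Variables (s x y : vec3 A) (c w : A).
Let t := vadd (vscale c s) (vscale w (vcross s x)).
Lemma vdot_rot_axis : vdot t x = c * vdot s x.
Proof. by rewrite /t /vdot /=; ring. Qed.
Lemma vdot_rot_other : vdot t y = c * vdot s y + w * vdot s (vcross x y).
Proof. by rewrite /t /vdot /=; ring. Qed.
Lemma vdot_rot_self : vdot t t =
  c * c * vdot s s + w * w * (vdot s s * vdot x x - vdot s x * vdot s x).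
Proof. by rewrite /t /vdot /=; ring. Qed.
Lemma vdot_rot_third :
  vdot t (vcross s x) = w * (vdot s s * vdot x x - vdot s x * vdot s x).
Proof. by rewrite /t /vdot /=; ring. Qed.
Lemma vdot_cross_self : vdot (vcross s x) (vcross s x) =
  vdot s s * vdot x x - vdot s x * vdot s x.
Proof. by rewrite /vdot /=; ring. Qed.
End Rotate.
End VecTheory.

(** * The quadratic rings R[e], e^2 = k *)

Definition quad (R : realType) (k : R) : Type := (R * R)%type.

Section QuadRing.
Variables (R : realType) (k : R).
Local Notation K := (quad k).
HB.instance Definition _ := GRing.Zmodule.copy K (R * R)%type.

Definition quad_mul (x y : K) : K :=
  (x.1 * y.1 + k * (x.2 * y.2), x.1 * y.2 + x.2 * y.1).
Definition quad_one : K := (1, 0).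

Fact quad_mulA : associative quad_mul.
Proof. by move=> x y z; congr pair => /=; ring. Qed.
Fact quad_mulC : commutative quad_mul.
Proof. by move=> x y; congr pair => /=; ring. Qed.
Fact quad_mul1 : left_id quad_one quad_mul.
Proof. by move=> [x y]; congr pair => /=; ring. Qed.
Fact quad_mulDl : left_distributive quad_mul +%R.
Proof. by move=> x y z; congr pair => /=; ring. Qed.
Fact quad_one_neq0 : quad_one != 0.
Proof. by apply/eqP => -[] /eqP; rewrite oner_eq0. Qed.

HB.instance Definition _ := GRing.Zmodule_isComNzRing.Build K
  quad_mulA quad_mulC quad_mul1 quad_mulDl quad_one_neq0.

Lemma quadM1 (x y : K) : (x * y).1 = x.1 * y.1 + k * (x.2 * y.2).
Proof. by []. Qed.
Lemma quadM2 (x y : K) : (x * y).2 = x.1 * y.2 + x.2 * y.1.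
Proof. by []. Qed.
Lemma quadD1 (x y : K) : (x + y).1 = x.1 + y.1.
Proof. by []. Qed.
Lemma quadD2 (x y : K) : (x + y).2 = x.2 + y.2.
Proof. by []. Qed.
Lemma quad_oneE : (1:K) = (1,0).
Proof. by []. Qed.
End QuadRing.

Section QuadTheory.
Variables (R : realType) (k : R).
Local Notation K := (quad k).

Lemma quadP (x y : K) : x.1 = y.1 -> x.2 = y.2 -> x = y.
Proof. by case: x => [? ?]; case: y => [? ?] /= -> ->. Qed.

Definition realq (r : R) : K := (r, 0).

Lemma realqM r s : realq r * realq s = realq (r * s).
Proof. by apply: quadP; rewrite ?quadM1 ?quadM2 /=; ring. Qed.
Lemma realqD r s : realq r + realq s = realq (r + s).
Proof. by apply: quadP; rewrite ?quadD1 ?quadD2 /=; ring. Qed.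

(** The conjugate c of d satisfies c d = N(d) and c c = tr(d) c - N(d), so for
    d <> 0 of norm zero it is the required z. *)
Lemma quad_unit_or_zero_divisor (d : K) :
  (exists d', d * d' = 1) \/
  exists (z : K) (t : R), [/\ z != 0, z * d = 0 & z * z = realq t * z].
Proof.
have [->|d0] := eqVneq d 0.
  right; exists 1, 1; split; rewrite ?oner_eq0 ?mulr0 //.
pose c : K := (d.1, - d.2); pose n := d.1 * d.1 - k * (d.2 * d.2).
have [n0|n0] := eqVneq n 0; last first.
  left; exists (realq n^-1 * c); apply: quadP;
    rewrite !(quadM1, quadM2) ?[1]quad_oneE /=.
    have -> : d.1 * (n^-1 * d.1 + k * (0 * - d.2)) +
      k * (d.2 * (n^-1 * - d.2 + 0 * d.1)) = n^-1 * n by rewrite /n; ring.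
    by rewrite mulVf.
  by ring.
right; exists c, (d.1 + d.1); split.
- apply: contra d0 => /eqP[d1 /eqP]; rewrite oppr_eq0 => /eqP d2.
  by apply/eqP; exact: quadP.
- apply: quadP; rewrite !(quadM1, quadM2) /=; last by ring.
  by rewrite -[RHS]n0 /n; ring.
- apply: quadP; rewrite !(quadM1, quadM2) /=; last by ring.
  apply/eqP; rewrite -subr_eq0; apply/eqP.
  by rewrite -[RHS]oppr0 -[in RHS]n0 /n; ring.
Qed.

Lemma realq_unit r : r != 0 -> realq r * realq r^-1 = 1.
Proof. by move=> r0; rewrite realqM divff. Qed.

Lemma realq_mul_eq0 r (z : K) : r != 0 -> realq r * z = 0 -> z = 0.
Proof.
move=> r0 /(congr1 ( *%R (realq r^-1))).
by rewrite mulr0 mulrA [realq _ * realq _]mulrC realq_unit // mul1r.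
Qed.

(** For z killing d, every c s + w (s x a) with w a multiple of z is orthogonal
    to a and to b, since its product with b is w d (s.s).  As z z is a real
    multiple of z, keeping the length of s amounts to finding a point with
    nonzero y on a real conic through the origin, which has a rational
    parametrization. *)
Lemma second_perpendicular (s a b : vec3 K) (d : K) (sg rh : R) :
  0 < sg -> 0 < rh -> vdot s s = realq sg -> vdot a a = realq rh ->
  vdot s a = 0 -> vdot s b = 0 -> vcross a b = vscale d s ->
  (exists d', d * d' = 1) \/
  exists t, [/\ vdot t t = realq sg, vdot t a = 0, vdot t b = 0 &
                vdot t (vcross s a) <> 0].
Proof.
move=> sg0 rh0 ss aa sa sb ab.
case: (quad_unit_or_zero_divisor d) => [|[z [t [z0 zd zz]]]]; [by left|right].
have D0 : 1 + rh * t ^+ 2 != 0.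
  by rewrite gt_eqF // ltr_pwDl // mulr_ge0 ?sqr_ge0 ?ltW.
(* c = 1 + p z and w = y z preserve the length iff this conic equation holds *)
have [y [p [y0 py]]] : exists y p : R, y != 0 /\
    p + p + (p * p + rh * (y * y)) * t = 0.
  exists (2 / (1 + rh * t ^+ 2)), (- (rh * t * (2 / (1 + rh * t ^+ 2)))).
  by split; [rewrite mulf_neq0 ?invr_eq0 ?pnatr_eq0 | field].
pose c : K := 1 + realq p * z; pose w := realq y * z.
exists (vadd (vscale c s) (vscale w (vcross s a))); split.
- rewrite vdot_rot_self sa ss aa mul0r subr0.
  have -> : c * c * realq sg + w * w * (realq sg * realq rh) =
     realq sg * (1 + realq (p + p) * z + realq (p * p + rh * (y * y)) * (z * z)).
    by rewrite /c /w -!realqD -!realqM; ring.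
  rewrite zz mulrA realqM -addrA -mulrDl realqD.
  by rewrite py mul0r addr0 mulr1.
- by rewrite vdot_rot_axis sa mulr0.
- rewrite vdot_rot_other sb ab vdotZr ss mulr0 add0r /w.
  have -> : realq y * z * (d * realq sg) = realq y * realq sg * (z * d) by ring.
  by rewrite zd mulr0.
- rewrite vdot_rot_third sa ss aa mul0r subr0 /w realqM.
  rewrite -mulrA [z * _]mulrC mulrA realqM => /realq_mul_eq0 e.
  move/eqP: z0; apply; apply: e.
  by rewrite !mulf_neq0 // gt_eqF.
Qed.
End QuadTheory.

(** * Linear combinations of polynomial equations *)

(** These reduce an equality modulo hypotheses to a polynomial identity, given
    the cofactors of the hypotheses. *)
Lemma eq_lin1 (A : comNzRingType) (c a b x y : A) :
  a = b -> x - y = c * (a - b) -> x = y.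
Proof. by move=> -> /eqP; rewrite subrr mulr0 subr_eq0 => /eqP. Qed.

Lemma eq_lin2 (A : comNzRingType) (c d a b a' b' x y : A) :
  a = b -> a' = b' -> x - y = c * (a - b) + d * (a' - b') -> x = y.
Proof. by move=> -> -> /eqP; rewrite !subrr !mulr0 addr0 subr_eq0 => /eqP. Qed.

Lemma eq_lin3 (A : comNzRingType) (c d e a b a' b' a'' b'' x y : A) :
  a = b -> a' = b' -> a'' = b'' ->
  x - y = c * (a - b) + d * (a' - b') + e * (a'' - b'') -> x = y.
Proof.
by move=> -> -> -> /eqP; rewrite !subrr !mulr0 !addr0 subr_eq0 => /eqP.
Qed.

(** * Homogeneous coordinates and Pluecker coordinates *)

Section Euclid.
Variable R : realType.
Implicit Types v w : vec3 R.
Lemma vsqr_ge0 v : 0 <= vdot v v.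
Proof. by rewrite /vdot -!expr2 !addr_ge0 ?sqr_ge0. Qed.
Lemma vsqr_eq0 v : vdot v v = 0 -> v = (0, 0, 0).
Proof.
case: v => [[a b] c]; rewrite /vdot -!expr2 /= => /eqP.
rewrite paddr_eq0 ?addr_ge0 ?sqr_ge0 // paddr_eq0 ?sqr_ge0 // !sqrf_eq0.
by case/andP=> /andP[/eqP -> /eqP ->] /eqP ->.
Qed.
Lemma cauchy_schwarz v w : vdot v w * vdot v w <= vdot v v * vdot w w.
Proof. by rewrite -subr_ge0 -vdot_cross_self vsqr_ge0. Qed.
Lemma vsqr_gt0 v : v <> (0, 0, 0) -> 0 < vdot v v.
Proof.
move=> v0; rewrite lt_neqAle vsqr_ge0 eq_sym andbT.
by apply/eqP => /vsqr_eq0.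
Qed.
Lemma v0dot v : vdot (0,0,0) v = 0.
Proof. by rewrite /vdot !mul0r !addr0. Qed.
Lemma vdotv0 v : vdot v (0,0,0) = 0.
Proof. by rewrite vdotC v0dot. Qed.
End Euclid.

Section LineCoordinates.
Variables (R : realType) (k : R).
Local Notation K := (quad k).

(** Homogeneous coordinates (x0, x) in R^4, with x0 split off. *)
Definition hvec : Type := (R * vec3 R)%type.
Implicit Types (x y a b : hvec) (q : vec3 K) (r s : R).

(** The two forms of Cayley-Klein geometry: the points are the vectors with
    [pform x x > 0], and [tform] restricted to the [pform]-orthogonal
    complement of a point is the metric of the tangent space there.  For
    k = 1 and k = -1 they are proportional; for k = 0 they are x0 y0, whose
    kernel is the plane at infinity, and the dot product, a metric on that
    plane. *)
Definition pform x y : R := x.1 * y.1 + k * vdot x.2 y.2.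
Definition tform x y : R := k * (x.1 * y.1) + vdot x.2 y.2.

Definition hzero : hvec := (0, (0, 0, 0)).
Definition hscale r x : hvec := (r * x.1, vscale r x.2).
Definition hcomb r x s y : hvec :=
  (r * x.1 + s * y.1, vadd (vscale r x.2) (vscale s y.2)).
Definition in_span a b x : Prop := exists r s, x = hcomb r a s b.

Definition line_coord (u m : vec3 R) : vec3 K :=
  ((u.1.1, m.1.1), (u.1.2, m.1.2), (u.2, m.2)).
Definition dirpart q : vec3 R := (q.1.1.1, q.1.2.1, q.2.1).
Definition mompart q : vec3 R := (q.1.1.2, q.1.2.2, q.2.2).

(** The Pluecker coordinates of the line through x and y: for two points
    x0 = y0 = 1 of Euclidean space the direction is y - x and the moment is
    the cross product of x with it. *)
Definition join x y : vec3 K :=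
  line_coord (vadd (vscale x.1 y.2) (vscale (- y.1) x.2)) (vcross x.2 y.2).

(** The exterior product of x with the bivector q vanishes. *)
Definition incident x q : Prop :=
  vscale x.1 (mompart q) = vcross x.2 (dirpart q) /\ vdot x.2 (mompart q) = 0.

(** The e-part of q.q is twice the Pluecker relation; positivity of the real
    part says that the line contains points of the space. *)
Definition proper_line q : Prop := exists2 r, 0 < r & vdot q q = realq k r.
End LineCoordinates.

(** Unfolding a vector identity to its entries: [hcoords] splits every vector
    in the context, [expand] every operation in the goal. *)
Ltac hcoords := repeat match goal with
  | x : hvec _ |- _ => destruct x as [? [[? ?] ?]]
  | x : vec3 _ |- _ => destruct x as [[? ?] ?]
  | x : Equality.sort (quad _) |- _ => destruct x as [? ?]
  | x : quad _ |- _ => destruct x as [? ?] end.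
Ltac expand :=
  rewrite /pform /tform /hcomb /hzero /hscale /vdot /vcross /vadd /vscale /=.

Section CayleyKlein.
Variables (R : realType) (k : R).
Hypothesis hk : [\/ k = 1, k = 0 | k = -1].
Local Notation K := (quad k).
Local Notation C := (pform k).
Local Notation B := (tform k).
Local Notation v0 := ((0, 0, 0) : vec3 K).
Implicit Types (x y a b d : hvec R) (q : vec3 K) (r s c e : R).

Lemma vdotE q q' : vdot q q' =
  (vdot (dirpart q) (dirpart q') + k * vdot (mompart q) (mompart q'),
   vdot (dirpart q) (mompart q') + vdot (mompart q) (dirpart q')).
Proof.
case: q => [[[u1 m1] [u2 m2]] [u3 m3]]; case: q' => [[[v1 n1] [v2 n2]] [v3 n3]].
by apply: quadP; rewrite /vdot /=; ring.
Qed.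

Lemma proper_lineP q : proper_line q <->
  0 < vdot (dirpart q) (dirpart q) + k * vdot (mompart q) (mompart q) /\
  vdot (dirpart q) (mompart q) = 0.
Proof.
split=> [[r r0]|[r0 h]].
  rewrite vdotE => -[-> h]; split=> //.
  by move: h; rewrite [vdot (mompart _) _]vdotC; lra.
exists (vdot (dirpart q) (dirpart q) + k * vdot (mompart q) (mompart q)) => //.
by rewrite vdotE [vdot (mompart _) (dirpart _)]vdotC h addr0.
Qed.

Lemma join_comb a b r s r' s' :
  join k (hcomb r a s b) (hcomb r' a s' b) =
  vscale (realq k (r * s' - s * r')) (join k a b).
Proof.
hcoords; rewrite /join /line_coord; expand.
by congr (_, _, _); apply: quadP; rewrite /=; ring.
Qed.

Lemma incident_join a b r s : incident (hcomb r a s b) (join k a b).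
Proof.
by hcoords; rewrite /incident /join /line_coord /dirpart /mompart; expand;
   split; [congr (_, _, _)|]; ring.
Qed.

Lemma incident_comb x y r s q :
  incident x q -> incident y q -> incident (hcomb r x s y) q.
Proof.
case: q => [[[u1 m1] [u2 m2]] [u3 m3]]; hcoords.
rewrite /incident /dirpart /mompart; expand => -[[e1 e2 e3] e0] [[f1 f2 f3] f0].
split; [congr (_, _, _)|];
  [apply: (eq_lin2 (c := r) (d := s) e1 f1)
  |apply: (eq_lin2 (c := r) (d := s) e2 f2)
  |apply: (eq_lin2 (c := r) (d := s) e3 f3)
  |apply: (eq_lin2 (c := r) (d := s) e0 f0)]; ring.
Qed.

Lemma pformC x y : C x y = C y x.
Proof. by hcoords; expand; ring. Qed.
Lemma pform_combr x r a s b : C x (hcomb r a s b) = r * C x a + s * C x b.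
Proof. by hcoords; expand; ring. Qed.
Lemma pform_scaler c x y : C x (hscale c y) = c * C x y.
Proof. by rewrite /hscale; hcoords; expand; ring. Qed.
Lemma pform0 x : C x (hzero R) = 0.
Proof. by hcoords; expand; ring. Qed.
Lemma hcomb_addsub x y c : y = hcomb c x 1 (hcomb 1 y (- c) x).
Proof. by hcoords; expand; congr (_, (_, _, _)); ring. Qed.
Lemma hcomb10 x y : hcomb 1 x 0 y = x.
Proof. by hcoords; expand; congr (_, (_, _, _)); ring. Qed.
Lemma hcomb0r c x y : hcomb c x 0 y = hscale c x.
Proof. by rewrite /hscale; hcoords; expand; congr (_, (_, _, _)); ring. Qed.
Lemma hscale1 x : hscale 1 x = x.
Proof. by rewrite -(hcomb0r 1 x x) hcomb10. Qed.
Lemma hscale_comb c r x s y : hscale c (hcomb r x s y) = hcomb (c * r) x (c * s) y.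
Proof. by rewrite /hscale; hcoords; expand; congr (_, (_, _, _)); ring. Qed.
Lemma join_combr x y r s : join k x (hcomb r x s y) = vscale (realq k s) (join k x y).
Proof. by rewrite -{1}(hcomb10 x y) join_comb mul1r mul0r subr0. Qed.
Lemma join_zero x : join k x (hzero R) = v0.
Proof.
by rewrite /join /line_coord; hcoords; expand; congr (_,_,_);
  apply: quadP => /=; ring.
Qed.
Lemma vscale_v0 (z : K) : vscale z v0 = v0.
Proof. by rewrite /vscale mulr0. Qed.

(** The tangent metric is positive definite; for k = -1 this is the reverse
    Cauchy-Schwarz inequality. *)
Lemma tangent_pos x b : 0 < C x x -> C x b = 0 -> b <> hzero R -> 0 < B b b.
Proof.
case: x => x0 x; case: b => b0 b; rewrite /pform /tform /hzero /= => xx xb bn.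
have bb := vsqr_ge0 b; have xx' := vsqr_ge0 x.
have [bz|/vsqr_gt0 bp] := pselect (b = (0,0,0)).
  have b0n : b0 <> 0 by move=> h; apply: bn; rewrite h bz.
  move: xb xx; rewrite bz !vdotv0 !mulr0 !addr0 => /eqP.
  rewrite mulf_eq0 (negbTE (introN eqP b0n)) orbF => /eqP ->.
  rewrite mul0r add0r; case: hk => -> h; last 2 first.
  - by move: h; rewrite mul0r ltxx.
  - by move: h; rewrite mulN1r oppr_gt0 ltNge xx'.
  by rewrite mul1r -expr2 exprn_even_gt0 //; apply/eqP.
case: hk => kE; rewrite kE in xx xb *.
- by rewrite mul1r ltr_wpDl // -expr2 sqr_ge0.
- by rewrite mul0r add0r.
have cs := cauchy_schwarz x b.
have x0b : x0 * b0 = vdot x b by lra.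
have x0p : 0 < x0 * x0 by lra.
rewrite -(pmulr_rgt0 _ x0p).
have -> : x0 * x0 * (-1 * (b0 * b0) + vdot b b) =
  (x0 * x0 - vdot x x) * vdot b b +
  (vdot x x * vdot b b - (x0 * b0) * (x0 * b0)) by ring.
rewrite x0b ltr_pwDl ?subr_ge0 // mulr_gt0 //; lra.
Qed.

(** A Lagrange identity: the product of two bivectors is a Gram determinant of
    the forms, and only the diagonal term is left for tangent vectors. *)
Lemma join_dot x b d : 0 < C x x -> C x b = 0 -> C x d = 0 ->
  vdot (join k x b) (join k x d) = realq k (C x x * B b d).
Proof.
move=> xx xb xd; rewrite vdotE; apply: quadP => /=; last first.
  by hcoords; rewrite /join /dirpart /mompart /line_coord; expand; rewrite /realq /=; ring.
(* the Gram determinant formula needs k^2 = 1; for k = 0 the error term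
   vanishes because tangent vectors lie at infinity *)
have gen : k * k = 1 \/ [/\ k = 0, b.1 = 0 & d.1 = 0].
  case: hk => kE;
    [by left; rewrite kE mulr1|right|by left; rewrite kE mulrNN mulr1].
  move: xx xb xd; rewrite /pform kE !mul0r !addr0 => xx.
  have x0 : x.1 != 0 by apply: contraL xx => /eqP ->; rewrite mul0r ltxx.
  by move=> /eqP; rewrite mulf_eq0 (negbTE x0) /= => /eqP -> /eqP;
     rewrite mulf_eq0 (negbTE x0) /= => /eqP ->.
have -> : vdot (dirpart (join k x b)) (dirpart (join k x d)) +
    k * vdot (mompart (join k x b)) (mompart (join k x d)) =
  C x x * B b d - k * (C x b * C x d) +
  (1 - k * k) * (vdot x.2 x.2 * (b.1 * d.1) - x.1 * d.1 * vdot x.2 b.2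
                 - x.1 * b.1 * vdot x.2 d.2 - k * (vdot x.2 b.2 * vdot x.2 d.2)).
  by clear; hcoords; rewrite /join /dirpart /mompart /line_coord; expand; ring.
rewrite xb; case: gen => [->|[-> -> ->]]; ring.
Qed.

(** b is the contraction of the bivector q with x, divided by [C x x]. *)
Lemma incident_join_tangent x q : 0 < C x x -> incident x q ->
  exists2 b, C x b = 0 & q = join k x b.
Proof.
move=> xx [e em].
pose i := (C x x)^-1.
have ii : C x x * i = 1 by rewrite divff // gt_eqF.
(* at the origin, x = (1, 0), this is b = (0, u) *)
exists (- (i * (k * vdot x.2 (dirpart q))),
        vscale i (vadd (vscale x.1 (dirpart q))
                       (vscale k (vcross (mompart q) x.2)))).
  by move: i {ii} => i; clear; move: q x => [[[u1 m1] [u2 m2]] [u3 m3]] x; hcoords;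
     rewrite /dirpart /mompart; expand; ring.
move: ii e em; rewrite /join /line_coord /=; move: i => i.
case: q => [[[u1 m1] [u2 m2]] [u3 m3]]; case: x {xx} => [x0 [[x1 x2] x3]].
rewrite /dirpart /mompart.
expand => ii [e1 e2 e3] e0.
congr (_, _, _); apply: quadP => /=; symmetry.
- by apply: (eq_lin3 (c := u1) (d := i * k * x3)
                    (e := - (i * k * x2)) ii e2 e3); ring.
- by apply: (eq_lin3 (c := m1) (d := - (i * x0))
                    (e := - (i * k * x1)) ii e1 e0); ring.
- by apply: (eq_lin3 (c := u2) (d := i * k * x1)
                    (e := - (i * k * x3)) ii e3 e1); ring.
- by apply: (eq_lin3 (c := m2) (d := - (i * x0))
                    (e := - (i * k * x2)) ii e2 e0); ring.
- by apply: (eq_lin3 (c := u3) (d := i * k * x2)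
                    (e := - (i * k * x1)) ii e1 e2); ring.
- by apply: (eq_lin3 (c := m3) (d := - (i * x0))
                    (e := - (i * k * x3)) ii e3 e0); ring.
Qed.

(** Cramer's rule, with one of the six Pluecker coordinates as the nonzero
    determinant. *)
Lemma incident_span a b x : join k a b <> ((0, 0, 0) : vec3 K) ->
  incident x (join k a b) -> in_span a b x.
Proof.
have key r s u : u != 0 -> u * x.1 = r * a.1 + s * b.1 ->
   u * x.2.1.1 = r * a.2.1.1 + s * b.2.1.1 ->
   u * x.2.1.2 = r * a.2.1.2 + s * b.2.1.2 ->
   u * x.2.2 = r * a.2.2 + s * b.2.2 -> in_span a b x.
  move=> u0 e0 e1 e2 e3; exists (u^-1 * r), (u^-1 * s).
  move: e0 e1 e2 e3; clear -u0; hcoords; expand => e0 e1 e2 e3.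
  by congr (_, (_, _, _)); rewrite -!mulrA -mulrDr -?e0 -?e1 -?e2 -?e3 mulKf.
move: key; case: a => a0 [[a1 a2] a3]; case: b => b0 [[b1 b2] b3].
case: x => x0 [[x1 x2] x3].
rewrite /incident /join /line_coord /dirpart /mompart; expand => key.
move=> nz [[e1 e2 e3] e0].
have [u1|u1] := eqVneq (a0 * b1 - b0 * a1) 0; last first.
  apply: (key (x0 * b1 - b0 * x1) (a0 * x1 - x0 * a1) _ u1); first by ring.
  - by ring.
  - by apply: (eq_lin1 (c := 1) e3); ring.
  - by apply: (eq_lin1 (c := -1) e2); ring.
have [u2|u2] := eqVneq (a0 * b2 - b0 * a2) 0; last first.
  apply: (key (x0 * b2 - b0 * x2) (a0 * x2 - x0 * a2) _ u2); first by ring.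
  - by apply: (eq_lin1 (c := -1) e3); ring.
  - by ring.
  - by apply: (eq_lin1 (c := 1) e1); ring.
have [u3|u3] := eqVneq (a0 * b3 - b0 * a3) 0; last first.
  apply: (key (x0 * b3 - b0 * x3) (a0 * x3 - x0 * a3) _ u3); first by ring.
  - by apply: (eq_lin1 (c := 1) e2); ring.
  - by apply: (eq_lin1 (c := -1) e1); ring.
  - by ring.
have [m1|m1] := eqVneq (a2 * b3 - a3 * b2) 0; last first.
  apply: (key (x2 * b3 - x3 * b2) (a2 * x3 - a3 * x2) _ m1).
  - by apply: (eq_lin1 (c := 1) e1); ring.
  - by apply: (eq_lin1 (c := 1) e0); ring.
  - by ring.
  - by ring.
have [m2|m2] := eqVneq (a3 * b1 - a1 * b3) 0; last first.
  apply: (key (x3 * b1 - x1 * b3) (a3 * x1 - a1 * x3) _ m2).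
  - by apply: (eq_lin1 (c := 1) e2); ring.
  - by ring.
  - by apply: (eq_lin1 (c := 1) e0); ring.
  - by ring.
have [m3|m3] := eqVneq (a1 * b2 - a2 * b1) 0; last first.
  apply: (key (x1 * b2 - x2 * b1) (a1 * x2 - a2 * x1) _ m3).
  - by apply: (eq_lin1 (c := 1) e3); ring.
  - by ring.
  - by ring.
  - by apply: (eq_lin1 (c := 1) e0); ring.
by case: nz; rewrite m1 m2 m3 !mulNr u1 u2 u3.
Qed.

(** If u is nonzero, the point is the foot of the perpendicular from the origin
    (1, 0).  If u = 0, which forces k = 1, the line lies in the plane x0 = 0 and
    consists of the vectors orthogonal to m. *)
Lemma proper_point q : proper_line q -> exists2 x, 0 < C x x & incident x q.
Proof.
case/proper_lineP; set u := dirpart q; set m := mompart q => qq um.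
have [u0|/vsqr_gt0 up] := pselect (u = (0, 0, 0)).
  move: qq; rewrite u0 v0dot add0r => mm.
  have k1 : k = 1.
    case: hk mm => [//|->|->]; rewrite ?mul0r ?ltxx // mulN1r oppr_gt0.
    by rewrite ltNge vsqr_ge0.
  have [r r0 rm] : exists2 r : vec3 R, r <> (0, 0, 0) & vdot r m = 0.
    have [e|n] := pselect ((m.1.2, - m.1.1, 0) = (0,0,0) :> vec3 R).
      exists (1, 0, 0); first by case=> /eqP; rewrite oner_eq0.
      by case: e => _ /eqP; rewrite oppr_eq0 /vdot /= => /eqP ->; ring.
    by exists (m.1.2, - m.1.1, 0) => //; rewrite /vdot /=; ring.
  exists (0, r); first by rewrite /pform k1 mul0r mul1r add0r; exact: vsqr_gt0.
  split=> //=; rewrite -/u -/m u0; clear; move: m => m; hcoords; expand.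
  by congr (_, _, _); ring.
exists (vdot u u, vcross u m).
  rewrite /pform /= vdot_cross_self um mulr0 subr0 mulrCA -mulrDr.
  exact: mulr_gt0.
rewrite /incident -/u -/m /=; move: um; clear.
case: u => [[u1 u2] u3]; case: m => [[m1 m2] m3]; expand => um.
split; last by ring.
congr (_, _, _); symmetry.
- by apply: (eq_lin1 (c := - u1) um); ring.
- by apply: (eq_lin1 (c := - u2) um); ring.
- by apply: (eq_lin1 (c := - u3) um); ring.
Qed.

Lemma proper_neq0 q : proper_line q -> q <> ((0,0,0) : vec3 K).
Proof.
move=> /proper_lineP[h _] q0; move: h; rewrite q0 /dirpart /mompart /=.
by rewrite v0dot mulr0 addr0 ltxx.
Qed.

(** Two bivectors whose exterior product vanishes have a common vector.  Let F
    be the exterior product with q.  The 2 x 2 minors of the pair F a, F b are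
    combinations of that exterior product and of the Pluecker relation of q, so
    F a and F b are proportional and some combination of a and b is
    incident to q. *)
Lemma concurrent a b q : vdot (dirpart q) (mompart q) = 0 ->
  (vdot (join k a b) q).2 = 0 -> join k a b <> ((0,0,0) : vec3 K) ->
  exists x, [/\ x <> hzero R, incident x (join k a b) & incident x q].
Proof.
move=> um; rewrite vdotE /=.
set v := dirpart q; set n := mompart q; set u := dirpart _; set m := mompart _.
move=> S0 ab0.
pose F (x : hvec R) : hvec R :=
  (vdot x.2 n, vadd (vscale x.1 n) (vscale (-1) (vcross x.2 v))).
have FP x : F x = hzero R -> incident x q.
  move=> e; have e1 := congr1 snd e; have := congr1 fst e; move: e1 {e}.
  rewrite /F /incident -/v -/n /=; clear.
  move: n v => n v; hcoords; expand => -[e1 e2 e3] ->.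
  by split=> //; congr (_,_,_); lra.
have Flin r s x y : F (hcomb r x s y) = hcomb r (F x) s (F y).
  by rewrite /F; clear; move: n v => n v; hcoords; expand; congr (_,(_,_,_)); ring.
have min0 : vadd (vscale (F a).1 (F b).2) (vscale (- (F b).1) (F a).2) = (0,0,0).
  have -> : (0,0,0) = vadd (vscale (- (vdot u n + vdot m v)) n) (vscale (vdot v n) m).
    by rewrite S0 um oppr0 !vscale0 vaddv0.
  rewrite /F /u /m; clear; move: n v => n v; rewrite /join /dirpart /mompart /line_coord.
  by hcoords; expand; congr (_,_,_); ring.
have min1 : vcross (F a).2 (F b).2 = (0,0,0).
  have -> : (0,0,0) = vadd (vscale (vdot u n + vdot m v) v) (vscale (- vdot v n) u).
    by rewrite S0 um oppr0 !vscale0 vaddv0.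
  rewrite /F /u /m; clear; move: n v => n v; rewrite /join /dirpart /mompart /line_coord.
  by hcoords; expand; congr (_,_,_); ring.
have pick r s : s != 0 -> hcomb r (F a) s (F b) = hzero R ->
   exists x, [/\ x <> hzero R, incident x (join k a b) & incident x q].
  move=> s0 h; exists (hcomb r a s b); split; last by apply: FP; rewrite Flin.
    move=> x0; apply: ab0; have := join_zero a.
    rewrite -x0 join_combr => /(congr1 (vscale (realq k s^-1))).
    by rewrite vscaleA realqM mulVf // vscale1 vscale_v0.
  exact: incident_join.
move: min0 min1 pick; move: {Flin} (F a) (FP a) (F b) => A Aq B0.
case: A Aq => A0 [[A1 A2] A3]; case: B0 => B0 [[B1 B2] B3]; expand.
move=> Aq [e1 e2 e3] [f1 f2 f3] pick.
have [h0|h0] := eqVneq A0 0; last first.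
  by apply: (pick B0 (- A0)); rewrite ?oppr_eq0 //; congr (_,(_,_,_)); lra.
have [h1|h1] := eqVneq A1 0; last first.
  by apply: (pick B1 (- A1)); rewrite ?oppr_eq0 //; congr (_,(_,_,_)); lra.
have [h2|h2] := eqVneq A2 0; last first.
  by apply: (pick B2 (- A2)); rewrite ?oppr_eq0 //; congr (_,(_,_,_)); lra.
have [h3|h3] := eqVneq A3 0; last first.
  by apply: (pick B3 (- A3)); rewrite ?oppr_eq0 //; congr (_,(_,_,_)); lra.
exists a; split; last by apply: Aq; rewrite h0 h1 h2 h3.
  move=> az; apply: ab0; rewrite az.
  by rewrite /join /line_coord; clear; hcoords; expand;
     congr (_, _, _); apply: quadP => /=; ring.
rewrite -{1}(hcomb10 a b).
exact: incident_join.
Qed.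

(** Perpendicular lines do not meet at or beyond infinity.  The three Gram
    relations of x with the directions and moments give, if [C x x <= 0], that
    x0 = 0 and that u, v are parallel: impossible in the Euclidean case by
    u.v = 0, and in the hyperbolic one by u.v = m.n, since the moments of proper
    lines are shorter than their directions. *)
Lemma meet_pointlike x q q' : x <> hzero R -> incident x q -> incident x q' ->
  proper_line q -> proper_line q' -> vdot q q' = 0 -> 0 < C x x.
Proof.
move=> x0 [e1 e0] [e1' e0'] /proper_lineP[qq um] /proper_lineP[qq' um'].
rewrite vdotE => -[qq0 _].
move: e1 e0 e1' e0' qq um qq' um' qq0.
set u := dirpart q; set m := mompart q; set v := dirpart q'; set n := mompart q'.
move=> e1 e0 e1' e0' qq um qq' um' qq0.
rewrite ltNge; apply/negP => Cx.
pose X := vdot x.2 x.2; pose s := vdot x.2 u; pose t := vdot x.2 v.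
have xu : x.1 * x.1 * vdot m m = X * vdot u u - s * s.
  by rewrite -vdot_cross_self -e1 vdotZl vdotZr mulrA.
have xv : x.1 * x.1 * vdot n n = X * vdot v v - t * t.
  by rewrite -vdot_cross_self -e1' vdotZl vdotZr mulrA.
have xuv : x.1 * x.1 * vdot m n = X * vdot u v - s * t.
  have <- : vdot (vcross x.2 u) (vcross x.2 v) = X * vdot u v - s * t.
    by rewrite /X /s /t; clear; move: u v => u v; hcoords; expand; ring.
  by rewrite -e1 -e1' vdotZl vdotZr mulrA.
have cs := cauchy_schwarz u v; have cs' := cauchy_schwarz m n.
have X0 : 0 <= X by exact: vsqr_ge0.
have x10 : 0 <= x.1 * x.1 by rewrite -expr2 sqr_ge0.
have Xp : x.1 = 0 -> 0 < X.
  move=> x1; apply: vsqr_gt0 => x2; apply: x0; move: x1 x2; clear.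
  by case: x => a b /= -> ->.
move: Cx qq qq' qq0 xu xv xuv cs cs' (vsqr_ge0 u) (vsqr_ge0 v)
  (vsqr_ge0 m) (vsqr_ge0 n).
rewrite /pform -/X; clear -hk X0 x10 Xp.
move: (vdot u u) (vdot v v) (vdot m m) (vdot n n) (vdot u v) (vdot m n)
  => P P' N N' g h.
move: X s t x.1 X0 x10 Xp => X s t x0 X0 X10 Xp.
case: hk => -> Cx qq qq' qq0 xu xv xuv cs cs' P0 P0' N0 N0'.
- have /eqP : x0 * x0 = 0 by lra.
  by rewrite mulf_eq0 orbb => /eqP /Xp; lra.
- have xx0 : x0 * x0 = 0 by lra.
  have /eqP : x0 * x0 = 0 by lra.
  rewrite mulf_eq0 orbb => /eqP /Xp Xpos; rewrite xx0 mul0r in xu xv xuv.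
  have XP : 0 < X * P by apply: mulr_gt0; lra.
  have sp : 0 < s * s by lra.
  have XP' : 0 < X * P' by apply: mulr_gt0; lra.
  have tp : 0 < t * t by lra.
  have g0 : g = 0 by lra.
  have : s * t = 0 by rewrite g0 in xuv; lra.
  move=> st; have := mulr_gt0 sp tp.
  by rewrite mulrACA st mul0r ltxx.
- pose E := X - x0 * x0; have E0 : 0 <= E by rewrite /E; lra.
  have PN : 0 < P - N by lra.
  have PN' : 0 < P' - N' by lra.
  have ss : s * s = E * P + x0 * x0 * (P - N) by rewrite /E; lra.
  have tt : t * t = E * P' + x0 * x0 * (P' - N') by rewrite /E; lra.
  have gh : g = h by lra.
  have st : s * t = E * g by rewrite gh in xuv *; rewrite /E; lra.
  have x0z : x0 = 0.
    have : (s * t) * (s * t) = (s * s) * (t * t) by ring.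
    rewrite st ss tt => e.
    have h1 : 0 <= E * E * (P * P' - g * g) by rewrite !mulr_ge0 //; lra.
    have h2 : 0 <= E * (x0 * x0) * (P * (P' - N') + P' * (P - N)).
      by apply: mulr_ge0; [exact: mulr_ge0|apply: addr_ge0; apply: mulr_ge0; lra].
    have : (x0 * x0) * (x0 * x0) * ((P - N) * (P' - N')) <= 0 by lra.
    rewrite pmulr_lle0 ?mulr_gt0 // => h3.
    have : (x0 * x0) * (x0 * x0) = 0 by have := mulr_ge0 X10 X10; lra.
    by move/eqP; rewrite !mulf_eq0 !orbb => /eqP.
  have Xpos := Xp x0z.
  have EX : E = X by rewrite /E x0z; lra.
  rewrite x0z EX in ss tt st.
  have : (s * t) * (s * t) = (s * s) * (t * t) by ring.
  rewrite st ss tt => e.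
  have : X * X * (P * P' - g * g) = 0 by lra.
  move/eqP; rewrite !mulf_eq0 !(gt_eqF Xpos) /= => /eqP e2.
  have : N * N' < P * P'.
    by apply: (@le_lt_trans _ _ (P * N'));
      [apply: ler_wpM2r; lra|rewrite ltr_pM2l; lra].
  have : g * g <= N * N' by rewrite gh.
  lra.
Qed.
Lemma tangentize x y : 0 < C x x ->
  exists c y', [/\ y = hcomb c x 1 y', C x y' = 0 & join k x y = join k x y'].
Proof.
move=> xx; exists (C x y / C x x), (hcomb 1 y (- (C x y / C x x)) x).
rewrite -hcomb_addsub pform_combr mul1r mulNr divfK ?gt_eqF // subrr; split=> //.
by rewrite {1}[y](hcomb_addsub x y (C x y / C x x)) join_combr vscale1.
Qed.

Lemma join_proper x y : 0 < C x x -> join k x y <> v0 -> proper_line (join k x y).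
Proof.
move=> xx; have [c [y' [_ xy' ->]]] := tangentize y xx.
move=> n; exists (C x x * B y' y'); last exact: join_dot.
rewrite mulr_gt0 //; apply: (tangent_pos xx xy') => y0.
by apply: n; rewrite y0 join_zero.
Qed.

Lemma join0_hscale x y : 0 < C x x -> join k x y = v0 -> exists c, y = hscale c x.
Proof.
move=> xx; have [c [y' [-> xy' ->]]] := tangentize y xx => j0.
exists c; have [->|/(tangent_pos xx xy') y'p] := pselect (y' = hzero R).
  by rewrite /hscale; clear; hcoords; expand; congr (_, (_, _, _)); ring.
have := join_dot xx xy' xy'; rewrite j0 /vdot !mul0r !addr0 => -[/eqP].
by rewrite eq_sym mulf_eq0 !gt_eqF.
Qed.

Lemma tangent_join_neq0 x b : 0 < C x x -> C x b = 0 -> b <> hzero R ->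
  join k x b <> v0.
Proof.
move=> xx xb bn /(join0_hscale xx)[c bE]; apply: bn.
move: xb; rewrite bE pform_scaler => /eqP; rewrite mulf_eq0 (gt_eqF xx) orbF.
by move=> /eqP ->; clear; rewrite /hscale; hcoords; expand; rewrite !mul0r.
Qed.

Lemma proper_through x y q : proper_line q -> 0 < C x x -> incident x q ->
  incident y q -> join k x y <> v0 ->
  exists c, q = vscale (realq k c) (join k x y).
Proof.
move=> qp xx xq yq; have [b _ qE] := incident_join_tangent xx xq.
rewrite qE in qp yq *.
have [r [s ->]] := incident_span (proper_neq0 qp) yq.
rewrite join_combr => n; exists s^-1; rewrite vscaleA realqM mulVf ?vscale1 //.
by apply/eqP => s0; apply: n; rewrite s0 vscale0.
Qed.

(** Being a point is an open condition, so every line has a second point. *)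
Lemma nearby_pointlike x b : 0 < C x x -> C x b = 0 ->
  exists2 e, e != 0 & 0 < C (hcomb 1 x e b) (hcomb 1 x e b).
Proof.
move=> xx xb; pose N := 1 + C x x + `|C b b|.
have N1 : 1 < N by rewrite /N -addrA ltrDl ltr_pwDl.
have N0 : 0 < N by apply: lt_trans N1.
pose e := C x x / N.
have e0 : 0 < e by rewrite divr_gt0.
have e1 : e < 1 by rewrite ltr_pdivrMr // mul1r /N; have := normr_ge0 (C b b); lra.
exists e; first by rewrite gt_eqF.
have -> : C (hcomb 1 x e b) (hcomb 1 x e b) = C x x + 2 * e * C x b + e * e * C b b.
  by clear; hcoords; expand; ring.
rewrite xb mulr0 addr0.
have h1 : e * `|C b b| < C x x.
  by rewrite /e mulrAC ltr_pdivrMr // ltr_pM2l // /N; lra.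
have h2 : e * e * `|C b b| <= e * `|C b b|.
  by rewrite ler_wpM2r // ler_piMr // ltW.
have h3 : - `|C b b| <= C b b by rewrite lerNl -normrN ler_norm.
have : e * e * - `|C b b| <= e * e * C b b by rewrite ler_wpM2l // mulr_ge0 // ltW.
rewrite mulrN; lra.
Qed.
End CayleyKlein.

(** * Lines, right angles and skewers in a model *)

(** A geometry whose points are the vectors of R^4 with [pform x x > 0], up to
    scaling, each with the choice [hom] of a representative.  Its tangent
    vectors at P are represented by [tvec] in the [pform]-complement of
    [hom P]. *)
Record klein_model (R : realType) (G : geometry R) (k : R) := KleinModel {
  hom : pt G -> hvec R;
  tvec : vect G -> hvec R;
  curvature : [\/ k = 1, k = 0 | k = -1];
  hom_pointlike : forall P, 0 < pform k (hom P) (hom P);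
  hom_surj : forall x, 0 < pform k x x ->
    exists P, exists2 c, c != 0 & hom P = hscale c x;
  hom_inj : forall P Q c, hom P = hscale c (hom Q) -> P = Q;
  tvec_surj : forall P b, pform k (hom P) b = 0 -> exists v, tvec v = b;
  innerE : forall u v : vect G, inner u v = tform k (tvec u) (tvec v);
  directionP : forall l P (v : vect G), direction l P v <->
    [/\ tvec v <> hzero R, pform k (hom P) (tvec v) = 0 &
        forall Q, l Q <-> in_span (hom P) (tvec v) (hom Q)];
  line_direction : forall l : set (pt G),
    is_line l <-> exists P v, direction l P v;
  line_throughP : forall A B : pt G, A <> B -> forall Q,
    line_through A B Q <-> in_span (hom A) (hom B) (hom Q);
  dual_orth : forall l m : set (pt G), dual_line l m ->
    k = 1 /\ forall P Q, l P -> m Q -> pform k (hom P) (hom Q) = 0;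
  concurrent_coplanar : forall (l m : set (pt G)) P,
    is_line l -> is_line m -> l P -> m P -> coplanar l m
}.

Section Model.
Variables (R : realType) (G : geometry R) (k : R) (M : klein_model G k).
Local Notation K := (quad k).
Local Notation C := (pform k).
Local Notation B := (tform k).
Local Notation v0 := ((0,0,0) : vec3 K).
Local Notation hom := (hom M).
Local Notation tvec := (tvec M).
Let hk := curvature M.
Implicit Types (l m s t : set (pt G)) (P Q : pt G) (q : vec3 K).

Definition coord_of l q : Prop :=
  proper_line q /\ forall P, l P <-> incident (hom P) q.

Lemma span_incident x y z : join k x y <> v0 ->
  in_span x y z <-> incident z (join k x y).
Proof.
move=> n; split=> [[r [c ->]]|]; [exact: incident_join|exact: incident_span].
Qed.

Lemma coord_of_direction l P v : direction l P v ->
  coord_of l (join k (hom P) (tvec v)).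
Proof.
move=> d; have [vn Pv lE] := (directionP M l P v).1 d; have PP := hom_pointlike M P.
have n := tangent_join_neq0 hk PP Pv vn.
split=> [|Q]; [exact: join_proper|rewrite lE; exact: span_incident].
Qed.

Lemma coord_of_through P Q : P <> Q ->
  coord_of (line_through P Q) (join k (hom P) (hom Q)).
Proof.
move=> PQ; have PP := hom_pointlike M P.
have n : join k (hom P) (hom Q) <> v0.
  by move=> /(join0_hscale hk PP)[c /hom_inj E]; apply: PQ.
split=> [|S]; first exact: join_proper.
by rewrite (line_throughP M PQ); exact: span_incident.
Qed.

Lemma line_coord_ex l : is_line l -> exists q, coord_of l q.
Proof.
move=> /(line_direction M)[P [v d]].
by exists (join k (hom P) (tvec v)); exact: coord_of_direction.
Qed.

Lemma proper_direction q P : proper_line q -> incident (hom P) q ->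
  exists l v, [/\ direction l P v, q = join k (hom P) (tvec v) & coord_of l q].
Proof.
move=> qp Pq; have PP := hom_pointlike M P.
have [b Pb qE] := incident_join_tangent PP Pq.
have [v vb] := tvec_surj Pb.
have bn : b <> hzero R.
  by move=> b0; apply: (proper_neq0 qp); rewrite qE b0 join_zero.
exists [set Q | incident (hom Q) q], v; rewrite vb; split=> //.
apply/(directionP M); rewrite vb; split=> // Q.
by rewrite qE /=; split=> /(span_incident _ (tangent_join_neq0 hk PP Pb bn)).
Qed.

Lemma line_of_proper q : proper_line q -> exists2 l, is_line l & coord_of l q.
Proof.
move=> qp; have [x xx xq] := proper_point hk qp.
have [P [c c0 Px]] := hom_surj M xx.
have Pq : incident (hom P) q.
  by rewrite Px -(hcomb0r c x x); exact: incident_comb.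
have [l [v [d _ lq]]] := proper_direction qp Pq.
by exists l => //; apply/(line_direction M); exists P, v.
Qed.

Lemma direction_coord l P q : coord_of l q -> l P ->
  exists v, direction l P v /\ q = join k (hom P) (tvec v).
Proof.
move=> [qp lE] /lE /(proper_direction qp)[l' [v [d qE [_ l'E]]]].
exists v; split=> //; suff -> : l = l' by [].
by apply/predeqP => Q; rewrite lE l'E.
Qed.

Lemma coord_point l q : coord_of l q -> exists P, l P.
Proof.
move=> [qp lE]; have [x xx xq] := proper_point hk qp.
have [P [c c0 Px]] := hom_surj M xx; exists P.
by apply/lE; rewrite Px -(hcomb0r c x x); exact: incident_comb.
Qed.

Lemma second_point l q P : coord_of l q -> l P ->
  exists Q, l Q /\ exists2 c, c != 0 &
    q = vscale (realq k c) (join k (hom P) (hom Q)).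
Proof.
move=> lq lP; have [v [d qE]] := direction_coord lq lP.
case: (lq) => [qp lE]; have PP := hom_pointlike M P.
have [vn Pv _] := (directionP M _ _ _).1 d.
have [e e0 ee] := nearby_pointlike PP Pv.
have [Q [c c0 QE]] := hom_surj M ee; exists Q.
have QE' : hom Q = hcomb (c * 1) (hom P) (c * e) (tvec v).
  by rewrite QE hscale_comb.
split; first by apply/lE; rewrite QE' qE; exact: incident_join.
exists (c * e)^-1; first by rewrite invr_eq0 mulf_neq0.
by rewrite QE' join_combr vscaleA realqM mulVf ?mulf_neq0 // vscale1.
Qed.

(** A line is determined by two points, and so are its coordinates, up to a
    real factor. *)
Lemma coord_of_uniq l q q' : coord_of l q -> coord_of l q' ->
  exists c, q' = vscale (realq k c) q.
Proof.
move=> lq lq'; have [P lP] := coord_point lq.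
have [Q [lQ [c c0 qE]]] := second_point lq lP.
have PP := hom_pointlike M P.
have n : join k (hom P) (hom Q) <> v0.
  by move=> j0; apply: (proper_neq0 lq.1); rewrite qE j0 vscale_v0.
have [e ->] := proper_through lq'.1 PP ((lq'.2 P).1 lP) ((lq'.2 Q).1 lQ) n.
by exists (e * c^-1); rewrite qE vscaleA realqM divfK.
Qed.

(** If q.q' = 0, the e-part yields a common vector ([concurrent]) and the real
    part makes it a point ([meet_pointlike]); at that point the real part is
    the inner product of the tangent vectors, by [join_dot]. *)
Lemma meet_at_right_angleP l m q q' : coord_of l q -> coord_of m q' ->
  meet_at_right_angle l m <-> vdot q q' = 0.
Proof.
move=> lq mq; split=> [[P [u [v [lu mv]]]]|qq].
  rewrite (innerE M) => uv.
  have [c ->] := coord_of_uniq (coord_of_direction lu) lq.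
  have [c' ->] := coord_of_uniq (coord_of_direction mv) mq.
  have [_ Pu _] := (directionP M _ _ _).1 lu;
  have [_ Pv _] := (directionP M _ _ _).1 mv.
  rewrite vdotZl vdotZr (join_dot hk (hom_pointlike M P) Pu Pv) uv mulr0.
  by rewrite (_ : realq k 0 = 0) ?mulr0.
have [a aa aq] := proper_point hk lq.1.
have [b ab qE] := incident_join_tangent aa aq.
have [x [x0 xq xq']] : exists x, [/\ x <> hzero R, incident x q & incident x q'].
  case/proper_lineP: (mq.1) => _ um; rewrite qE; apply: concurrent => //.
    by rewrite -qE qq.
  by rewrite -qE; exact: proper_neq0 lq.1.
have xx := meet_pointlike hk x0 xq xq' lq.1 mq.1 qq.
have [P [c c0 Px]] := hom_surj M xx.
have inc (z : vec3 K) : incident x z -> incident (hom P) z.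
  by move=> xz; rewrite Px -(hcomb0r c x x); exact: incident_comb.
have [u [lu uE]] := direction_coord lq ((lq.2 P).2 (inc _ xq)).
have [v [mv vE]] := direction_coord mq ((mq.2 P).2 (inc _ xq')).
exists P, u, v; split=> //; rewrite (innerE M).
have [_ Pu _] := (directionP M _ _ _).1 lu;
  have [_ Pv _] := (directionP M _ _ _).1 mv.
move: qq; rewrite uE vE (join_dot hk (hom_pointlike M P) Pu Pv) => -[/eqP].
by rewrite mulf_eq0 (gt_eqF (hom_pointlike M P)) => /eqP.
Qed.

(** The ring element e; multiplication by it maps an elliptic line to its
    dual. *)
Definition imunit : K := (0, 1).

Lemma orth_incident a b y : k = 1 -> C a y = 0 -> C b y = 0 ->
  incident y (vscale imunit (join k a b)).
Proof.
rewrite /incident /join /line_coord /imunit /dirpart /mompart => k1 ay yb.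
have {}ay : a.1 * y.1 = - vdot a.2 y.2 by move: ay; rewrite /pform k1; lra.
have {}yb : b.1 * y.1 = - vdot b.2 y.2 by move: yb; rewrite /pform k1; lra.
rewrite k1; move: ay yb; clear.
case: a => a0 [[a1 a2] a3]; case: b => b0 [[b1 b2] b3].
case: y => y0 [[y1 y2] y3]; expand => ay yb; split.
  congr (_, _, _).
  - by apply: (eq_lin2 (c := b1) (d := - a1) ay yb); ring.
  - by apply: (eq_lin2 (c := b2) (d := - a2) ay yb); ring.
  - by apply: (eq_lin2 (c := b3) (d := - a3) ay yb); ring.
by apply: (eq_lin2 (c := - b0) (d := a0) ay yb); ring.
Qed.

(** Every point of m is orthogonal to every point of l, which makes it incident
    with e q; so c is a real multiple of e. *)
Lemma dual_coord l m q q' : dual_line l m -> coord_of l q -> coord_of m q' ->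
  exists c, q' = vscale c q.
Proof.
move=> /(dual_orth M)[k1 orth] lq mq.
have [P lP] := coord_point lq; have [P' [lP' [c c0 qE]]] := second_point lq lP.
have [Q mQ] := coord_point mq; have [Q' [mQ' [c' c0' qE']]] := second_point mq mQ.
have inc S : m S -> incident (hom S) (vscale imunit (join k (hom P) (hom P'))).
  by move=> mS; apply: orth_incident => //; exact: orth.
have jp : proper_line (vscale imunit (join k (hom P) (hom P'))).
  have [r r0 jj] : proper_line (join k (hom P) (hom P')).
    apply: (join_proper hk); first exact: hom_pointlike.
    by move=> j0; apply: (proper_neq0 lq.1); rewrite qE j0 vscale_v0.
  exists r => //; rewrite vdotZl vdotZr jj.
  by apply: quadP; rewrite /imunit k1 /=; ring.
have n : join k (hom Q) (hom Q') <> v0.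
  by move=> j0; apply: (proper_neq0 mq.1); rewrite qE' j0 vscale_v0.
have [e eE] := proper_through jp (hom_pointlike M Q) (inc _ mQ) (inc _ mQ') n.
have e0 : e != 0.
  by apply/eqP => e0; apply: (proper_neq0 jp); rewrite eE e0 vscale0.
have -> : q' = vscale (realq k (c' * e^-1))
                 (vscale (realq k e) (join k (hom Q) (hom Q'))).
  by rewrite qE' vscaleA realqM divfK.
rewrite -eE qE; exists (realq k (c' * e^-1) * imunit * realq k c^-1).
by rewrite !vscaleA -(mulrA _ (realq k c^-1)) realqM mulVf // mulr1.
Qed.

(** If d were not invertible, [second_perpendicular] would give a skewer t that
    is not orthogonal to s x a; but s, its K-multiples, and in particular its
    dual are orthogonal to it. *)
Lemma unique_skewer_cross s a b qs qa qb :
  is_the_skewer s a b -> coord_of s qs -> coord_of a qa -> coord_of b qb ->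
  exists d d', vcross qa qb = vscale d qs /\ d * d' = 1.
Proof.
move=> [[sl sa sb] suniq] cs ca cb.
have {}sa := (meet_at_right_angleP cs ca).1 sa.
have {}sb := (meet_at_right_angleP cs cb).1 sb.
have [sg sg0 ss] := cs.1; have [rh rh0 aa] := ca.1.
have ss1 : vdot qs qs * realq k sg^-1 = 1 by rewrite ss realq_unit // gt_eqF.
have ab := cross_perp_collinear sa sb ss1.
move: ab; move: (_ * _) => d ab.
have [[d' dd]|[qt [tt ta tb tr]]] :=
  second_perpendicular sg0 rh0 ss aa sa sb ab; first by exists d, d'.
have pt : proper_line qt by exists sg.
have [t tl ct] := line_of_proper pt.
have ts : skewer t a b.
  by split=> //; [apply/(meet_at_right_angleP ct ca)
                 |apply/(meet_at_right_angleP ct cb)].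
have [c tE] : exists c, qt = vscale c qs.
  case: (suniq t ts) => [ts_eq|dst]; last exact: dual_coord dst cs ct.
  by rewrite ts_eq in ct; have [c ->] := coord_of_uniq cs ct; exists (realq k c).
case: tr; rewrite tE vdotZl.
by rewrite (_ : vdot qs (vcross qs qa) = 0) ?mulr0 // /vdot /=; ring.
Qed.

Lemma join_bilinear (a b c d : hvec R) (r r' s s' : R) :
  join k (hcomb r a r' b) (hcomb s c s' d) =
  vadd (vadd (vscale (realq k r * realq k s) (join k a c))
             (vscale (realq k r * realq k s') (join k a d)))
       (vadd (vscale (realq k r' * realq k s) (join k b c))
             (vscale (realq k r' * realq k s') (join k b d))).
Proof.
rewrite !realqM; clear; rewrite /join /line_coord; hcoords; expand.
by congr (_,_,_); apply: quadP => /=; ring.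
Qed.

(** The hypothesis on s1 and s2 is what turns the vector q1 x q2, which need
    not represent a line, into a multiple of the vector of one. *)
Lemma common_perpendicular s1 s2 s3 q1 q2 q3 :
  coord_of s1 q1 -> coord_of s2 q2 -> coord_of s3 q3 ->
  vdot q1 (vcross q2 q3) = 0 -> has_unique_skewer s1 s2 ->
  exists t, is_line t /\ meet_at_right_angle t s1 /\ meet_at_right_angle t s2 /\
    meet_at_right_angle t s3.
Proof.
move=> c1 c2 c3 det0 [t ht]; exists t; have [[tl t1 t2] _] := ht.
split=> //; split=> //; split=> //.
have [qt ct] := line_coord_ex tl.
have [d [d' [E dd]]] := unique_skewer_cross ht ct c1 c2.
apply/(meet_at_right_angleP ct c3).
rewrite -[qt]vscale1 -dd mulrC -vscaleA -E vdotZl.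
by rewrite vdotC vdot_cross_rot det0 mulr0.
Qed.

(** Skewness of L and N ensures A_i <> B_j, hence that the line through them is
    given by the join. *)
Theorem skewer_pappus (L N : set (pt G))
  (hL : is_line L) (hN : is_line N) (hskew : ~ coplanar L N)
  (A1 A2 A3 B1 B2 B3 : pt G)
  (hA1 : L A1) (hA2 : L A2) (hA3 : L A3)
  (hB1 : N B1) (hB2 : N B2) (hB3 : N B3)
  (s1 s2 s3 : set (pt G))
  (hs1 : is_the_skewer s1 (line_through A1 B2) (line_through A2 B1))
  (hs2 : is_the_skewer s2 (line_through A2 B3) (line_through A3 B2))
  (hs3 : is_the_skewer s3 (line_through A3 B1) (line_through A1 B3))
  (hgen : has_unique_skewer s1 s2 \/ has_unique_skewer s2 s3
          \/ has_unique_skewer s3 s1) :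
  exists t : set (pt G),
    is_line t /\ meet_at_right_angle t s1 /\ meet_at_right_angle t s2
    /\ meet_at_right_angle t s3.
Proof.
have ne A S : L A -> N S -> A <> S.
  by move=> LA NS AS; apply/hskew/(concurrent_coplanar M hL hN LA); rewrite AS.
have cAB A S : L A -> N S -> coord_of (line_through A S) (join k (hom A) (hom S)).
  by move=> LA NS; exact: coord_of_through (ne _ _ LA NS).
have [q1 c1] : exists q, coord_of s1 q
  by case: hs1 => -[sl _ _] _; exact: line_coord_ex.
have [q2 c2] : exists q, coord_of s2 q
  by case: hs2 => -[sl _ _] _; exact: line_coord_ex.
have [q3 c3] : exists q, coord_of s3 q
  by case: hs3 => -[sl _ _] _; exact: line_coord_ex.
have [d1 [d1' [E1 u1]]] :=
  unique_skewer_cross hs1 c1 (cAB _ _ hA1 hB2) (cAB _ _ hA2 hB1).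
have [d2 [d2' [E2 u2]]] :=
  unique_skewer_cross hs2 c2 (cAB _ _ hA2 hB3) (cAB _ _ hA3 hB2).
have [d3 [d3' [E3 u3]]] :=
  unique_skewer_cross hs3 c3 (cAB _ _ hA3 hB1) (cAB _ _ hA1 hB3).
have det0 : vdot q1 (vcross q2 q3) = 0.
  have : vdot (vscale d1 q1) (vcross (vscale d2 q2) (vscale d3 q3)) = 0.
    rewrite -E1 -E2 -E3.
    have [P [v /(directionP M)[_ _ LE]]] := (line_direction M L).1 hL.
    have [Q [w /(directionP M)[_ _ NE]]] := (line_direction M N).1 hN.
    have [a1 [a1' ->]] := (LE _).1 hA1; have [a2 [a2' ->]] := (LE _).1 hA2.
    have [a3 [a3' ->]] := (LE _).1 hA3.
    have [b1 [b1' ->]] := (NE _).1 hB1; have [b2 [b2' ->]] := (NE _).1 hB2.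
    have [b3 [b3' ->]] := (NE _).1 hB3.
    by rewrite !join_bilinear; exact: pappus_identity.
  rewrite vcrossZ vdotZl vdotZr => /(congr1 ( *%R (d1' * d2' * d3'))).
  rewrite mulr0 => <-.
  have -> : d1' * d2' * d3' * (d1 * (d2 * d3 * vdot q1 (vcross q2 q3))) =
    (d1 * d1') * (d2 * d2') * (d3 * d3') * vdot q1 (vcross q2 q3) by ring.
  by rewrite u1 u2 u3 !mul1r.
case: hgen => [h|[h|h]].
- exact: common_perpendicular c1 c2 c3 det0 h.
- have [|t [tl [t2 [t3 t1]]]] := common_perpendicular c2 c3 c1 _ h.
    by rewrite -vdot_cross_rot.
  by exists t.
- have [|t [tl [t3 [t1 t2]]]] := common_perpendicular c3 c1 c2 _ h.
    by rewrite vdot_cross_rot.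
  by exists t.
Qed.
End Model.

(** * Subspaces and coordinates *)

Section Subspaces.
Variables (F : fieldType) (V : vectType F).
Implicit Types (U W : {vspace V}) (x y b : V).

Lemma dim1_vline U : \dim U = 1%N -> vpick U != 0 /\ U = <[vpick U]>%VS.
Proof.
move=> U1; have p0 : vpick U != 0.
  by apply: contra_eqN U1; rewrite vpick0 => /eqP ->; rewrite dimv0.
split=> //; apply/eqP; rewrite eq_sym eqEdim U1 dim_vline p0 andbT.
by rewrite -memvE memv_pick.
Qed.

Lemma dim2_split U x : \dim U = 2%N -> x \in U -> x != 0 ->
  exists b, U = (<[x]> + <[b]>)%VS.
Proof.
move=> U2 xU x0; have [|_ bE] := @dim1_vline (U :\: <[x]>)%VS.
  have := dimv_cap_compl U <[x]>%VS.
  by rewrite (capv_idPr _) -?memvE // dim_vline x0 U2 add1n => -[].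
exists (vpick (U :\: <[x]>)%VS); rewrite -bE addvC.
by rewrite -{1}(addv_diff_cap U <[x]>) (capv_idPr _) // -memvE.
Qed.

Lemma dim_span2 x b : x != 0 -> b \notin <[x]>%VS -> \dim (<[x]> + <[b]>) = 2%N.
Proof.
move=> x0 bx; rewrite dimv_disjoint_sum ?dim_vline ?x0.
  by rewrite (contraNneq _ bx) // => ->; rewrite mem0v.
apply/eqP; rewrite -subv0; apply/subvP => z; rewrite memv_cap memv0.
case/andP=> zx /vlineP[c zE]; move: zx; rewrite zE.
have [->|c0] := eqVneq c 0; first by rewrite scale0r.
by move=> /(memvZ c^-1); rewrite scalerA mulVf // scale1r (negbTE bx).
Qed.

Lemma extend_subspace U n : (\dim U <= n <= \dim {:V})%N ->
  exists W, (U <= W)%VS /\ \dim W = n.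
Proof.
case/andP; elim: n => [|n IH]; first by rewrite leqn0 => /eqP; exists U.
rewrite leq_eqVlt => /orP[/eqP <- _|Un nV]; first by exists U.
have [W [UW Wn]] := IH Un (ltnW nV).
pose v := vpick W^C%VS.
have v0 : v != 0.
  rewrite vpick0 -dimv_eq0 dimv_compl Wn subn_eq0 -ltnNge.
  exact: nV.
have vW : v \in W^C%VS by exact: memv_pick.
exists (W + <[v]>)%VS; split; first exact: subv_trans UW (addvSl _ _).
rewrite dimv_disjoint_sum ?dim_vline ?v0 ?Wn ?addn1 //.
apply/eqP; rewrite -subv0 -(capv_compl W) capvS //.
Qed.
End Subspaces.

Section Coordinates.
Variable R : realType.

Definition coords3 (x : 'rV[R]_3) : vec3 R :=
  (x 0 ord0, x 0 (lift ord0 ord0), x 0 (lift ord0 (lift ord0 ord0))).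
Definition coords4 (x : 'rV[R]_4) : hvec R :=
  (x 0 ord0, (x 0 (lift ord0 ord0), x 0 (lift ord0 (lift ord0 ord0)),
              x 0 (lift ord0 (lift ord0 (lift ord0 ord0))))).
Definition row3 (v : vec3 R) : 'rV[R]_3 :=
  \row_(i < 3) nth 0 [:: v.1.1; v.1.2; v.2] i.
Definition row4 (x : hvec R) : 'rV[R]_4 :=
  \row_(i < 4) nth 0 [:: x.1; x.2.1.1; x.2.1.2; x.2.2] i.

Lemma row3K v : coords3 (row3 v) = v.
Proof. by case: v => [[a b] c]; rewrite /coords3 !mxE. Qed.
Lemma row4K x : coords4 (row4 x) = x.
Proof. by case: x => [a [[b c] d]]; rewrite /coords4 !mxE. Qed.

Lemma coords3_inj : injective coords3.
Proof.
move=> x y [e0 e1 e2]; apply/rowP => i.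
case: (unliftP ord0 i) => [{}i|] -> //.
case: (unliftP ord0 i) => [{}i|] -> //.
case: (unliftP ord0 i) => [{}i|] -> //.
by case: i.
Qed.

Lemma coords4_inj : injective coords4.
Proof.
move=> x y [e0 e1 e2 e3]; apply/rowP => i.
case: (unliftP ord0 i) => [{}i|] -> //.
case: (unliftP ord0 i) => [{}i|] -> //.
case: (unliftP ord0 i) => [{}i|] -> //.
case: (unliftP ord0 i) => [{}i|] -> //.
by case: i.
Qed.

Lemma coords4_lin r x s y :
  coords4 (r *: x + s *: y) = hcomb r (coords4 x) s (coords4 y).
Proof. by rewrite /coords4 !mxE. Qed.

Lemma coords4Z r x : coords4 (r *: x) = hscale r (coords4 x).
Proof. by rewrite /coords4 !mxE. Qed.

Lemma coords4_eq0 x : coords4 x = hzero R <-> x = 0.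
Proof.
have z : coords4 0 = hzero R by rewrite /coords4 !mxE.
by rewrite -z; split=> [/coords4_inj|->].
Qed.

Lemma dot3E x y : dot x y = vdot (coords3 x) (coords3 y).
Proof. by rewrite /dot !big_ord_recl big_ord0 /vdot /= addr0 !addrA. Qed.

Lemma dot4E x y : dot x y = pform 1 (coords4 x) (coords4 y).
Proof.
by rewrite /dot !big_ord_recl big_ord0 /pform /vdot /= addr0 mul1r !addrA.
Qed.

Lemma lorentzE x y : lorentz x y = tform (-1) (coords4 x) (coords4 y).
Proof.
by rewrite /lorentz !big_ord_recl big_ord0 /tform /vdot /= addr0 mulN1r !addrA.
Qed.

Lemma memv_span2 x b y : (y \in <[x]> + <[b]>)%VS <->
  in_span (coords4 x) (coords4 b) (coords4 y).
Proof.
split.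
  case/memv_addP => _ /vlineP[r ->] [_ /vlineP[s ->] ->].
  by exists r, s; exact: coords4_lin.
case=> r [s]; rewrite -coords4_lin => /coords4_inj ->.
by apply: memv_add; rewrite memvZ // memv_line.
Qed.
End Coordinates.

(** * The three spaces *)

Section EuclideanModel.
Variable R : realType.
Local Notation V := 'rV[R]_3.
Implicit Types P Q v : V.

(** The affine space R^3 is the chart x0 = 1, with its vectors in the plane
    x0 = 0 at infinity. *)
Definition euclid_hom P : hvec R := (1, coords3 P).
Definition euclid_tvec v : hvec R := (0, coords3 v).

Lemma coords3_lin (r s : R) P Q :
  coords3 (r *: P + s *: Q) = vadd (vscale r (coords3 P)) (vscale s (coords3 Q)).
Proof. by rewrite /coords3 !mxE. Qed.

Lemma flat_mem P (U : {vspace V}) Q : flat P U Q <-> Q - P \in U.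
Proof. by []. Qed.

Lemma flat_shift p P (U : {vspace V}) : flat p U P -> flat p U = flat P U.
Proof.
move=> /flat_mem Pp; apply/predeqP => Q; rewrite !flat_mem.
have -> : Q - p = (Q - P) + (P - p) by rewrite addrA subrK.
by rewrite rpredDr.
Qed.

Lemma flat_lineP P v Q :
  flat P <[v]>%VS Q <-> in_span (euclid_hom P) (euclid_tvec v) (euclid_hom Q).
Proof.
rewrite flat_mem; split=> [/vlineP[r QE]|[r [s]]].
  exists 1, r; rewrite /hcomb /= mulr1 mulr0 addr0 -coords3_lin -QE scale1r.
  by rewrite addrC subrK.
rewrite /hcomb /= mulr1 mulr0 addr0 -coords3_lin => e.
have /= rE := congr1 fst e; have /= /coords3_inj -> := congr1 snd e.
rewrite -rE.
by rewrite scale1r addrC addKr memvZ // memv_line.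
Qed.

Lemma euclid_tvec0 v : euclid_tvec v = hzero R <-> v = 0.
Proof.
split=> [[e0 e1 e2]|->]; last by rewrite /euclid_tvec /coords3 !mxE.
by apply: coords3_inj; rewrite /coords3 e0 e1 e2 !mxE.
Qed.

Lemma euclid_directionP l P v : @direction R (euclidean R) l P v <->
  [/\ euclid_tvec v <> hzero R, pform 0 (euclid_hom P) (euclid_tvec v) = 0 &
      forall Q, l Q <-> in_span (euclid_hom P) (euclid_tvec v) (euclid_hom Q)].
Proof.
split=> [[v0 ->]|[v0 _ lE]].
  split; last by move=> Q; exact: flat_lineP.
    by move=> /euclid_tvec0 /eqP; rewrite (negbTE v0).
  by rewrite /pform /= mulr0 mul0r addr0.
split; first by apply/eqP => /euclid_tvec0.
by apply/predeqP => Q; rewrite lE flat_lineP.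
Qed.

Lemma euclid_concurrent (l m : set (pt (euclidean R))) P :
  is_line l -> is_line m -> l P -> m P -> coplanar l m.
Proof.
move=> [p [U [U1 ->]]] [p' [U' [U1' ->]]] /flat_shift -> /flat_shift ->.
have [|W [sW W2]] := @extend_subspace _ _ (U + U')%VS 2.
  rewrite dimvf andbT; move: (dimv_add_leqif U U').1; rewrite U1 U1'.
  exact.
exists (flat P W); split; first by exists P, W.
- by move=> Q; exact: (subvP (subv_trans (addvSl U U') sW)).
- by move=> Q; exact: (subvP (subv_trans (addvSr U U') sW)).
Qed.

Definition euclidean_model : klein_model (euclidean R) 0.
Proof.
apply: (@KleinModel R (euclidean R) 0 euclid_hom euclid_tvec).
- by constructor 2.
- by move=> P; rewrite /pform /= mul0r addr0 mulr1.
- move=> [x0 x]; rewrite /pform /= mul0r addr0 => xx.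
  have x0n : x0 != 0 by apply: contraL xx => /eqP ->; rewrite mul0r ltxx.
  exists (row3 (vscale x0^-1 x)), x0^-1; first by rewrite invr_eq0.
  by rewrite /euclid_hom row3K /hscale /= mulVf.
- by move=> P Q c [/esym]; rewrite mulr1 => -> e0 e1 e2; apply: coords3_inj;
    rewrite /coords3 e0 e1 e2 !mul1r.
- move=> P [b0 b]; rewrite /pform /= mul1r mul0r addr0 => ->.
  by exists (row3 b); rewrite /euclid_tvec row3K.
- by move=> u v; rewrite /tform /= mul0r add0r -dot3E.
- exact: euclid_directionP.
- move=> l; split=> [[p [U [/dim1_vline[v0 UE] ->]]]|[P [v [v0 ->]]]].
    by exists p, (vpick U); split=> //; rewrite -UE.
  by exists P, <[v]>%VS; rewrite dim_vline v0.
- move=> A B _ Q; rewrite /= flat_lineP.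
  have BA : euclid_tvec (B - A) = hcomb (-1) (euclid_hom A) 1 (euclid_hom B).
    rewrite /hcomb /= !mulr1 addNr -coords3_lin scaleN1r scale1r.
    by rewrite addrC.
  split=> [[r [s ->]]|[r [s e]]].
    exists (r - s), s; rewrite BA.
    by move: (euclid_hom A) (euclid_hom B); clear=> a b; hcoords; expand;
      congr (_, (_, _, _)); ring.
  exists (r + s), s; rewrite e BA.
  by move: (euclid_hom A) (euclid_hom B); clear=> a b; hcoords; expand;
      congr (_, (_, _, _)); ring.
- by [].
- exact: euclid_concurrent.
Defined.
End EuclideanModel.

Section Planes.
Variables (R : realType) (k : R).
Local Notation V := 'rV[R]_4.
Implicit Types (U W : {vspace V}) (p u : V).

Lemma coplanar_subspace U W p : \dim U = 2%N -> \dim W = 2%N ->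
  p \in U -> p \in W -> p != 0 ->
  exists T, [/\ (U <= T)%VS, (W <= T)%VS & \dim T = 3%N].
Proof.
move=> U2 W2 pU pW p0; have [|T [sT T3]] := @extend_subspace _ _ (U + W)%VS 3.
  have cap0 : (0 < \dim (U :&: W))%N.
    rewrite lt0n dimv_eq0; apply: contra p0 => /eqP UW.
    by rewrite -memv0 -UW memv_cap pU.
  have := dimv_sum_cap U W; rewrite U2 W2 dimvf andbT => e.
  by rewrite -(leq_add2r (\dim (U :&: W))) e (leq_add2l 3 1).
by exists T; split=> //; apply: subv_trans sT; rewrite ?addvSl ?addvSr.
Qed.

Lemma plane_tangent_basis U p : \dim U = 2%N -> p \in U ->
  0 < pform k (coords4 p) (coords4 p) ->
  exists u, [/\ u != 0, pform k (coords4 p) (coords4 u) = 0 &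
               U = (<[p]> + <[u]>)%VS].
Proof.
move=> U2 pU pp.
have p0 : p != 0 by apply/eqP => /coords4_eq0 pz; move: pp; rewrite pz pform0 ltxx.
have [b bE] := dim2_split U2 pU p0.
pose c := pform k (coords4 p) (coords4 b) / pform k (coords4 p) (coords4 p).
have UE : U = (<[p]> + <[b - c *: p]>)%VS.
  rewrite bE; apply/eqP; rewrite eqEsubv !subv_add -!memvE.
  have pm (x : V) : p \in (<[p]> + <[x]>)%VS
    by rewrite (subvP (addvSl _ _)) ?memv_line.
  have xm (x : V) : x \in (<[p]> + <[x]>)%VS
    by rewrite (subvP (addvSr _ _)) ?memv_line.
  rewrite !pm /=; apply/andP; split; last by rewrite rpredB ?xm // memvZ ?pm.
  by rewrite -[in X in X \in _](subrK (c *: p) b) rpredD ?xm // memvZ ?pm.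
exists (b - c *: p); split=> //.
  apply/eqP => u0; move: U2; rewrite UE u0.
  by rewrite (_ : <[0]>%VS = 0%VS) ?addv0 ?dim_vline ?p0 //; apply/eqP;
     rewrite -dimv_eq0 dim_vline eqxx.
rewrite (_ : b - c *: p = 1 *: b + (- c) *: p); last by rewrite scale1r scaleNr.
rewrite coords4_lin pform_combr mul1r mulNr /c divfK ?gt_eqF //.
by rewrite subrr.
Qed.

Lemma dim_tangent_span p u : u != 0 -> 0 < pform k (coords4 p) (coords4 p) ->
  pform k (coords4 p) (coords4 u) = 0 -> \dim (<[p]> + <[u]>) = 2%N.
Proof.
move=> u0 pp pu; have p0 : p != 0.
  by apply/eqP => /coords4_eq0 pz; move: pp; rewrite pz pform0 ltxx.
apply: dim_span2 => //; apply: contra u0 => /vlineP[c uE]; move: pu.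
rewrite uE coords4Z pform_scaler => /eqP; rewrite mulf_eq0 (gt_eqF pp) orbF.
by move/eqP ->; rewrite scale0r.
Qed.

Lemma coords4_neq0 u : u != 0 <-> coords4 u <> hzero R.
Proof. by split=> [/eqP h /coords4_eq0|h]; [|apply/eqP => /coords4_eq0]. Qed.
End Planes.

Section HyperbolicModel.
Variable R : realType.
Local Notation V := 'rV[R]_4.
Local Notation H := (hyperbolic R).
Implicit Types (P Q : hpoint R) (u : V).

Definition hyp_hom P : hvec R := coords4 (val P).

Lemma pform_lorentz (x y : V) :
  pform (-1) (coords4 x) (coords4 y) = - lorentz x y.
Proof. by rewrite lorentzE /pform /tform; ring. Qed.

Lemma hyp_pointlike P : 0 < pform (-1) (hyp_hom P) (hyp_hom P).
Proof.
by rewrite pform_lorentz; case: P => x /= /andP[/eqP -> _]; rewrite opprK.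
Qed.

Lemma htraceP (U : {vspace V}) Q : htrace U Q <-> val Q \in U.
Proof. by []. Qed.

Lemma hyp_directionP (l : set (pt H)) P u : @direction R H l P u <->
  [/\ coords4 u <> hzero R, pform (-1) (hyp_hom P) (coords4 u) = 0 &
      forall Q, l Q <-> in_span (hyp_hom P) (coords4 u) (hyp_hom Q)].
Proof.
rewrite /= pform_lorentz; split=> [[/coords4_neq0 u0 Pu ->]|[/coords4_neq0 u0 Pu lE]].
  by split=> [//||Q]; [rewrite Pu oppr0|rewrite htraceP memv_span2].
split=> //; first by apply/eqP; rewrite -oppr_eq0 Pu.
by apply/predeqP => Q; rewrite lE htraceP memv_span2.
Qed.

Lemma hyp_surj x : 0 < pform (-1) x x ->
  exists P, exists2 c, c != 0 & hyp_hom P = hscale c x.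
Proof.
move=> xx; pose n := pform (-1) x x.
have x0 : x.1 != 0.
  apply/eqP => x0; move: xx; rewrite /pform x0 mul0r add0r mulN1r oppr_gt0.
  by rewrite ltNge vsqr_ge0.
pose c := Num.sg x.1 / Num.sqrt n.
have sn : 0 < Num.sqrt n by rewrite sqrtr_gt0.
have c0 : c != 0 by rewrite mulf_neq0 ?sgr_eq0 // invr_eq0 gt_eqF.
have hx : (lorentz (row4 (hscale c x)) (row4 (hscale c x)) == -1) &&
    (0 < (row4 (hscale c x)) 0 ord0).
  apply/andP; split.
    rewrite -eqr_oppLR -pform_lorentz row4K pform_scaler pformC pform_scaler.
    rewrite mulrA -/n /c mulrACA -!expr2 sqr_sg x0 mul1r exprVn.
    by rewrite sqr_sqrtr ?ltW // mulVf // gt_eqF.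
  by rewrite mxE /= /c mulrAC mulrC mulr_gt0 ?invr_gt0 // -normrEsg normr_gt0.
pose P : hpoint R := exist _ (row4 (hscale c x)) hx.
by exists P, c => //; rewrite /hyp_hom /= row4K.
Qed.

Lemma hyp_inj P Q (c : R) : hyp_hom P = hscale c (hyp_hom Q) -> P = Q.
Proof.
move=> PQ; apply: val_inj; apply: coords4_inj; rewrite -/(hyp_hom P) PQ.
have := congr1 fst PQ; have := congr1 (fun x => pform (-1) x x) PQ.
rewrite pform_scaler pformC pform_scaler /hyp_hom !pform_lorentz /=.
case: P {PQ} => x /= /andP[/eqP -> x0]; case: Q => y /= /andP[/eqP -> y0].
rewrite opprK mulr1 => cc cE; have c0 : 0 < c.
  by move: x0; rewrite cE pmulr_lgt0.
have /eqP : (c - 1) * (c + 1) = 0 by rewrite -subr_sqr_1 expr2 -cc subrr.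
rewrite mulf_eq0 (gt_eqF (addr_gt0 c0 ltr01)) orbF subr_eq0 => /eqP ->.
by rewrite hscale1.
Qed.

Lemma hyp_line_direction (l : set (pt H)) :
  is_line l <-> exists P v, @direction R H l P v.
Proof.
split=> [[U [U2 -> [P /htraceP PU]]]|[P [u [u0 Pu ->]]]].
  have [u [u0 Pu UE]] := plane_tangent_basis U2 PU (hyp_pointlike P).
  exists P, u; split=> //; last by rewrite -UE.
  by apply/eqP; rewrite -oppr_eq0 -pform_lorentz; apply/eqP.
exists (<[val P]> + <[u]>)%VS; split=> //.
  apply: (dim_tangent_span u0 (hyp_pointlike P)).
  by rewrite pform_lorentz Pu oppr0.
by exists P; rewrite htraceP (subvP (addvSl _ _)) ?memv_line.
Qed.

Lemma hyp_concurrent (l m : set (pt H)) P :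
  is_line l -> is_line m -> l P -> m P -> coplanar l m.
Proof.
move=> [U [U2 -> _]] [W [W2 -> _]] /htraceP PU /htraceP PW.
have p0 : val P != 0.
  apply/eqP => /coords4_eq0 pz; have := hyp_pointlike P.
  by rewrite /hyp_hom pz pform0 ltxx.
have [T [UT WT T3]] := coplanar_subspace U2 W2 PU PW p0.
exists (htrace T); split; last 2 first.
- by move=> Q /htraceP /(subvP UT).
- by move=> Q /htraceP /(subvP WT).
by exists T; split=> //; exists P; rewrite htraceP (subvP UT).
Qed.

Definition hyperbolic_model : klein_model H (-1).
Proof.
apply: (@KleinModel R H (-1) hyp_hom (@coords4 R)).
- by constructor 3.
- exact: hyp_pointlike.
- exact: hyp_surj.
- exact: hyp_inj.
- by move=> P b _; exists (row4 b); rewrite row4K.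
- exact: lorentzE.
- exact: hyp_directionP.
- exact: hyp_line_direction.
- by move=> A B _ Q; rewrite /= htraceP memv_span2.
- by [].
- exact: hyp_concurrent.
Defined.
End HyperbolicModel.

Section EllipticModel.
Variable R : realType.
Local Notation V := 'rV[R]_4.
Local Notation E := (elliptic R).
Implicit Types (P Q : epoint R) (u : V).

Definition ell_hom P : hvec R := coords4 (vpick (val P)).

Lemma ell_vline P : vpick (val P) != 0 /\ val P = <[vpick (val P)]>%VS.
Proof. by apply: dim1_vline; apply/eqP; exact: (valP P). Qed.

Lemma ell_pointlike P : 0 < pform 1 (ell_hom P) (ell_hom P).
Proof.
have [p0 _] := ell_vline P; rewrite -dot4E /dot.
rewrite lt_def; apply/andP; split; last first.
  by apply: sumr_ge0 => i _; rewrite -expr2 sqr_ge0.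
apply: contra p0 => /eqP s0; apply/eqP/rowP => i; rewrite mxE; apply/eqP.
move/psumr_eq0P: s0 => /(_ (fun i _ => sqr_ge0 _)) /(_ i isT) /eqP.
by rewrite mulf_eq0 orbb.
Qed.

Lemma projP (U : {vspace V}) Q : proj U Q <-> vpick (val Q) \in U.
Proof. by rewrite /proj /= {1}(ell_vline Q).2 -memvE. Qed.

Lemma ell_orth P u : (forall x : V, x \in val P -> dot x u = 0) <->
  pform 1 (ell_hom P) (coords4 u) = 0.
Proof.
rewrite -dot4E; split=> [|Pu x]; first by apply; exact: memv_pick.
rewrite (ell_vline P).2 => /vlineP[c ->].
by rewrite dot4E coords4Z pformC pform_scaler pformC -dot4E Pu mulr0.
Qed.

Lemma ell_directionP (l : set (pt E)) P u : @direction R E l P u <->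
  [/\ coords4 u <> hzero R, pform 1 (ell_hom P) (coords4 u) = 0 &
      forall Q, l Q <-> in_span (ell_hom P) (coords4 u) (ell_hom Q)].
Proof.
rewrite /=; split=> [[/coords4_neq0 u0 /ell_orth Pu ->]
                    |[/coords4_neq0 u0 /ell_orth Pu lE]].
  by split=> // Q; rewrite projP {1}(ell_vline P).2 memv_span2.
split=> //; apply/predeqP => Q.
by rewrite lE projP {1}(ell_vline P).2 memv_span2.
Qed.

Lemma ell_surj x : 0 < pform 1 x x ->
  exists P, exists2 c, c != 0 & ell_hom P = hscale c x.
Proof.
move=> xx; have x0 : row4 x != 0.
  by apply/coords4_neq0; rewrite row4K => xz; move: xx; rewrite xz pform0 ltxx.
have x1 : \dim <[row4 x]> == 1%N by rewrite dim_vline x0.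
pose P : epoint R := exist _ <[row4 x]>%VS x1; exists P.
have [p0 _] := ell_vline P.
have /vlineP[c cE] : vpick (val P) \in <[row4 x]>%VS by exact: memv_pick.
exists c; last by rewrite /ell_hom cE coords4Z row4K.
by apply: contraNneq p0 => c0; rewrite cE c0 scale0r.
Qed.

Lemma ell_inj P Q (c : R) : ell_hom P = hscale c (ell_hom Q) -> P = Q.
Proof.
rewrite /ell_hom -coords4Z => /coords4_inj PQ; apply: val_inj.
have [p0 PE] := ell_vline P; have [q0 QE] := ell_vline Q.
apply/eqP; rewrite eqEdim (eqP (valP P)) (eqP (valP Q)) leqnn andbT PE PQ.
by rewrite -memvE memvZ // memv_pick.
Qed.

Lemma ell_line_direction (l : set (pt E)) :
  is_line l <-> exists P v, @direction R E l P v.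
Proof.
split=> [[U [U2 ->]]|[P [u [u0 /ell_orth Pu ->]]]]; last first.
  exists (val P + <[u]>)%VS; split=> //; rewrite {1}(ell_vline P).2.
  exact: dim_tangent_span u0 (ell_pointlike P) Pu.
have U0 : vpick U != 0 by rewrite vpick0 -dimv_eq0 U2.
have u1 : \dim <[vpick U]> == 1%N by rewrite dim_vline U0.
pose P : epoint R := exist _ <[vpick U]>%VS u1; exists P.
have PU : vpick (val P) \in U.
  by rewrite (subvP _ _ (memv_pick _)) //= -memvE memv_pick.
have [u [un Pu UE]] := plane_tangent_basis U2 PU (ell_pointlike P).
exists u; split=> //; first exact/ell_orth.
by rewrite (ell_vline P).2 -UE.
Qed.

Lemma ell_concurrent (l m : set (pt E)) P :
  is_line l -> is_line m -> l P -> m P -> coplanar l m.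
Proof.
move=> [U [U2 ->]] [W [W2 ->]] /projP PU /projP PW.
have [T [UT WT T3]] := coplanar_subspace U2 W2 PU PW (ell_vline P).1.
exists (proj T); split; first by exists T.
- by move=> Q /projP /(subvP UT) /projP.
- by move=> Q /projP /(subvP WT) /projP.
Qed.

Definition elliptic_model : klein_model E 1.
Proof.
apply: (@KleinModel R E 1 ell_hom (@coords4 R)).
- by constructor 1.
- exact: ell_pointlike.
- exact: ell_surj.
- exact: ell_inj.
- by move=> P b _; exists (row4 b); rewrite row4K.
- by move=> u v; rewrite /= dot4E /tform /pform !mul1r.
- exact: ell_directionP.
- exact: ell_line_direction.
- move=> A B _ Q; rewrite /= projP {1}(ell_vline A).2 {1}(ell_vline B).2.
  by rewrite memv_span2.
- move=> l m [U [W [_ UW -> ->]]]; split=> // P Q /projP PU /projP QW.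
  by rewrite -dot4E; exact: (UW _).1 QW _ PU.
- exact: ell_concurrent.
Defined.
End EllipticModel.

Theorem theorem2 (R : realType) (X : space_kind)
  (L M : set (pt (geometry_of R X)))
  (hL : is_line L) (hM : is_line M) (hskew : ~ coplanar L M)
  (A1 A2 A3 B1 B2 B3 : pt (geometry_of R X))
  (hA1 : L A1) (hA2 : L A2) (hA3 : L A3)
  (hB1 : M B1) (hB2 : M B2) (hB3 : M B3)
  (s1 s2 s3 : set (pt (geometry_of R X)))
  (hs1 : is_the_skewer s1 (line_through A1 B2) (line_through A2 B1))
  (hs2 : is_the_skewer s2 (line_through A2 B3) (line_through A3 B2))
  (hs3 : is_the_skewer s3 (line_through A3 B1) (line_through A1 B3))
  (hgen : has_unique_skewer s1 s2 \/ has_unique_skewer s2 s3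
          \/ has_unique_skewer s3 s1) :
  exists t : set (pt (geometry_of R X)),
    is_line t /\ meet_at_right_angle t s1 /\ meet_at_right_angle t s2
    /\ meet_at_right_angle t s3.
Proof.
case: X => /= in L M hL hM hskew A1 A2 A3 B1 B2 B3 hA1 hA2 hA3 hB1 hB2 hB3
                s1 s2 s3 hs1 hs2 hs3 hgen *.
- exact: (skewer_pappus (euclidean_model R) hL hM hskew hA1 hA2 hA3
            hB1 hB2 hB3 hs1 hs2 hs3 hgen).
- exact: (skewer_pappus (hyperbolic_model R) hL hM hskew hA1 hA2 hA3
            hB1 hB2 hB3 hs1 hs2 hs3 hgen).
- exact: (skewer_pappus (elliptic_model R) hL hM hskew hA1 hA2 hA3
            hB1 hB2 hB3 hs1 hs2 hs3 hgen).
Qed.
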